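(* Let $\Phi(t)$ be a smooth one-parameter family of $\operatorname{Spin}(7)$-structures on the smooth $8$-manifold $M$, with associated metrics $g=g(t)$, satisfying $$\frac{\partial}{\partial t}\Phi_{ijkl} = A_{im} g^{mn}\Phi_{njkl} + A_{jm} g^{mn}\Phi_{inkl} + A_{km} g^{mn}\Phi_{ijnl} + A_{lm} g^{mn}\Phi_{ijkn},$$ where $A_{ij}=h_{ij}+X_{ij}$, $h=h(t)$ is a symmetric $2$-tensor and $X=X(t)\in\Omega^2_7$ (with respect to $\Phi(t)$). Then the torsion tensor $T_{m;\alpha\beta}$ of $\Phi(t)$ evolves by $$\frac{\partial}{\partial t} T_{m;\alpha\beta} = A_{\alpha p} g^{pq} T_{m;q\beta} - A_{\beta p} g^{pq} T_{m;q\alpha} + \pi_7\left( \nabla_{\beta} h_{\alpha m} - \nabla_{\alpha} h_{\beta m} + \nabla_{m} X_{\alpha\beta} \right),$$ where $\pi_7$ denotes the projection onto $\Omega^2_7$ of the tensor which, for fixed $m$, is skew-symmetric in $\alpha,\beta$.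
   Context: A $\operatorname{Spin}(7)$-structure on a smooth $8$-manifold $M$ (not necessarily compact) is a smooth $4$-form $\Phi$ such that at each point there is a basis $e^1,\dots,e^8$ of the cotangent space in which $\Phi = -\big(e^{1234}+e^{1256}+e^{1278}+e^{3456}+e^{3478}+e^{5678}+e^{1357}-e^{1368}-e^{1458}-e^{1467}-e^{2358}-e^{2367}-e^{2457}+e^{2468}\big)$, where $e^{ijkl}=e^i\wedge e^j\wedge e^k\wedge e^l$. It determines a Riemannian metric $g=g_\Phi$ and an orientation, for which such a basis is oriented orthonormal; then $\ast\Phi=\Phi$. In local coordinates $\Phi=\frac1{24}\Phi_{ijkl}dx^i\wedge dx^j\wedge dx^k\wedge dx^l$, repeated indices are summed, and the sign convention is such that $\Phi_{ijkl}\Phi_{abcd}g^{kc}g^{ld}=6g_{ia}g_{jb}-6g_{ib}g_{ja}-4\Phi_{ijab}$. $\nabla$ is the Levi-Civita connection of $g$. The bundle of $2$-forms splits orthogonally as $\Omega^2=\Omega^2_7\oplus\Omega^2_{21}$, where $\Omega^2_7=\{\beta: \ast(\Phi\wedge\beta)=-3\beta\}$ and $\Omega^2_{21}=\{\beta:\ast(\Phi\wedge\beta)=\beta\}$. The projection onto $\Omega^2_7$ is $\pi_7(\beta)_{ij}=\frac14\beta_{ij}-\frac18\beta_{ab}g^{ap}g^{bq}\Phi_{pqij}$. Torsion tensor: it is known that for each $m$ there is a unique $T_{m;ab}$, lying in $\Omega^2_7$ as a skew tensor in $a,b$, with $\nabla_m\Phi_{ijkl}=T_{m;ip}g^{pq}\Phi_{qjkl}+T_{m;jp}g^{pq}\Phi_{iqkl}+T_{m;kp}g^{pq}\Phi_{ijql}+T_{m;lp}g^{pq}\Phi_{ijkq}$;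 the tensor $T$ is the torsion tensor of $\Phi$. *)

(* Defs.v *)
From HB Require Import structures.
From mathcomp Require Import all_boot all_order all_algebra all_fingroup.
From mathcomp Require Import all_classical all_reals all_analysis.

Set Implicit Arguments.
Unset Strict Implicit.
Unset Printing Implicit Defensive.

Import Order.TTheory GRing.Theory Num.Theory.
Import numFieldNormedType.Exports.

Local Open Scope classical_set_scope.
Local Open Scope ring_scope.

(** Smoothness on an open subset of a finite-dimensional normed space: all
    iterated directional derivatives exist and are continuous. *)

Fixpoint Ck_on (R : realType) (V W : normedModType R) (k : nat) (U : set V)
    (f : V -> W) : Prop :=
  (forall x, U x -> {for x, continuous f}) /\
  (if k is k'.+1 then
     forall v, (forall x, U x -> derivable f x v) /\
               Ck_on k' U (fun x => 'D_v f x)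
   else True).

Definition smooth_on (R : realType) (V W : normedModType R) (U : set V)
    (f : V -> W) : Prop := forall k, Ck_on k U f.

(** Smooth 8-manifolds, given by an atlas (not required to be maximal).
    [param c] is the inverse of the chart [coord c]. *)

Record manifold8 (R : realType) := Manifold8 {
  carrier :> topologicalType;
  chart : Type;
  dom : chart -> set carrier;
  coord : chart -> carrier -> 'rV[R]_8;
  param : chart -> 'rV[R]_8 -> carrier;
  manifold_hausdorff : hausdorff_space carrier;
  manifold_second_countable : @second_countable carrier;
  dom_open : forall c, open (dom c);
  dom_cover : forall p, exists c, dom c p;
  coordK : forall c p, dom c p -> param c (coord c p) = p;
  coord_open : forall c, open (coord c @` dom c);
  coord_continuous : forall c p, dom c p -> {for p, continuous (coord c)};
  param_continuous : forall c x, (coord c @` dom c) x ->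
    {for x, continuous (param c)};
  transition_smooth : forall c d,
    smooth_on (coord c @` (dom c `&` dom d)) (coord d \o param c) }.

Definition chart_image (R : realType) (M : manifold8 R) (c : chart M) :
  set 'rV[R]_8 := coord c @` dom c.

(** A covariant [k]-tensor on a tangent space, as the array of its components in
    a coordinate system; the indices 1..8 are the elements 0..7 of ['I_8]. *)

Definition tensor (R : Type) (k : nat) := k.-tuple 'I_8 -> R.

(** A covariant tensor field assigns to a chart [c] and [x] in
    [chart_image c] its components in [c] at the point with coordinates [x];
    values at other [x] are irrelevant. *)

Definition tfield (R : realType) (M : manifold8 R) (k : nat) :=
  chart M -> 'rV[R]_8 -> tensor R k.

Definition tensorial (R : realType) (M : manifold8 R) (k : nat)
    (S : tfield M k) : Prop :=
  forall (c d : chart M) (x : 'rV[R]_8),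
    (coord c @` (dom c `&` dom d)) x ->
    let y := coord d \o param c in
    forall s : k.-tuple 'I_8,
      S c x s = \sum_(u : k.-tuple 'I_8)
        (\prod_(r < k) 'D_('e_(tnth s r)) (fun z => y z ord0 (tnth u r)) x) *
        S d (y x) u.

Definition smooth_tfield (R : realType) (M : manifold8 R) (k : nat)
    (S : tfield M k) : Prop :=
  tensorial S /\
  forall c s, smooth_on (chart_image c) (fun x => S c x s).

(** Joint smoothness in the parameter and the point. *)

Definition smooth_family (R : realType) (M : manifold8 R) (k : nat) (J : set R)
    (S : R -> tfield M k) : Prop :=
  (forall t, J t -> tensorial (S t)) /\
  forall c s, smooth_on (J `*` chart_image c)
                (fun z : R * 'rV[R]_8 => S z.1 c z.2 s).

(** Exterior algebra in components, with the convention
    alpha = (1 / k!) alpha_(i1 .. ik) dx^i1 /\ .. /\ dx^ik. *)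

Definition wedge (R : realType) (p q : nat) (a : tensor R p) (b : tensor R q) :
    tensor R (p + q) := fun s =>
  (p`! * q`!)%:R^-1 * \sum_(w : 'S_(p + q)) (-1) ^+ w *
    a [tuple tnth s (w (lshift q i)) | i < p] *
    b [tuple tnth s (w (rshift p j)) | j < q].

(** Hodge star for the metric with matrix [g] and the volume form [vol]. *)

Definition hodge (R : realType) (p q : nat) (g : 'M[R]_8)
    (vol : tensor R (p + q)) (eta : tensor R p) : tensor R q := fun s =>
  p`!%:R^-1 * \sum_(a : p.-tuple 'I_8) \sum_(b : p.-tuple 'I_8)
    eta a * (\prod_(r < p) invmx g (tnth a r) (tnth b r)) *
    vol [tuple of b ++ s].

(** A coframe e^1, .., e^8 is a matrix whose row [i.-1] holds the components of
    e^i; [e4 e i j k l] is e^i /\ e^j /\ e^k /\ e^l for i, j, k, l in 1..8. *)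

Definition e4 (R : realType) (e : 'M[R]_8) (i j k l : nat) : tensor R 4 :=
  fun s => \det (\matrix_(r < 4, q < 4)
                   e (inord (nth 0%N [:: i; j; k; l] r).-1) (tnth s q)).

Definition spin7_form (R : realType) (e : 'M[R]_8) : tensor R 4 := fun s =>
  - (e4 e 1 2 3 4 s + e4 e 1 2 5 6 s + e4 e 1 2 7 8 s + e4 e 3 4 5 6 s
     + e4 e 3 4 7 8 s + e4 e 5 6 7 8 s + e4 e 1 3 5 7 s - e4 e 1 3 6 8 s
     - e4 e 1 4 5 8 s - e4 e 1 4 6 7 s - e4 e 2 3 5 8 s - e4 e 2 3 6 7 s
     - e4 e 2 4 5 7 s + e4 e 2 4 6 8 s).

Definition adapted (R : realType) (phi : tensor R 4) (e : 'M[R]_8) : Prop :=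
  e \in unitmx /\ phi = spin7_form e.

(** The choice of the adapted coframe is immaterial for the metric and the
    volume form below: the stabilizer of the standard form in GL(8) is Spin(7),
    a subgroup of SO(8). *)

Definition adapted_coframe (R : realType) (phi : tensor R 4) : 'M[R]_8 :=
  xget 1%:M [set e | adapted phi e].

Definition metric (R : realType) (phi : tensor R 4) : 'M[R]_8 :=
  (adapted_coframe phi)^T *m adapted_coframe phi.

Definition metric_inv (R : realType) (phi : tensor R 4) : 'M[R]_8 :=
  invmx (metric phi).

Definition volume_form (R : realType) (phi : tensor R 4) : tensor R 8 :=
  fun s => \det (\matrix_(i, j) adapted_coframe phi i (tnth s j)).

Definition Omega2_7 (R : realType) (phi : tensor R 4) (b : tensor R 2) : Prop :=
  (forall i j, b [tuple i; j] = - b [tuple j; i]) /\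
  @hodge R 6 2 (metric phi) (volume_form phi) (wedge phi b) =
    (fun s => - 3 * b s).

Definition pi7 (R : realType) (phi : tensor R 4) (b : 'I_8 -> 'I_8 -> R)
    (i j : 'I_8) : R :=
  4^-1 * b i j - 8^-1 * \sum_(a < 8) \sum_(c < 8) \sum_(p < 8) \sum_(q < 8)
    b a c * metric_inv phi a p * metric_inv phi c q * phi [tuple p; q; i; j].

(** The infinitesimal action of a 2-tensor on the 4-form [phi]:
    B_(im) g^(mn) phi_(njkl) + .. + B_(lm) g^(mn) phi_(ijkn). *)

Definition diamond (R : realType) (phi : tensor R 4) (B : tensor R 2)
    (i j k l : 'I_8) : R :=
  \sum_(m < 8) \sum_(n < 8) metric_inv phi m n *
    (B [tuple i; m] * phi [tuple n; j; k; l] +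
     B [tuple j; m] * phi [tuple i; n; k; l] +
     B [tuple k; m] * phi [tuple i; j; n; l] +
     B [tuple l; m] * phi [tuple i; j; k; n]).

Section Fields.
Variables (R : realType) (M : manifold8 R).

Definition spin7_structure (Phi : tfield M 4) : Prop :=
  smooth_tfield Phi /\
  forall c x, chart_image c x -> exists e, adapted (Phi c x) e.

(** Gamma^p_(ij), and [nabla Phi S c x m s], the component [s] of nabla_m S,
    for the Levi-Civita connection of the metric of [Phi]. *)

Definition christoffel (Phi : tfield M 4) (c : chart M) (x : 'rV[R]_8)
    (p i j : 'I_8) : R :=
  2^-1 * \sum_(q < 8) metric_inv (Phi c x) p q *
    ('D_('e_i) (fun y => metric (Phi c y) j q) x +
     'D_('e_j) (fun y => metric (Phi c y) i q) x -
     'D_('e_q) (fun y => metric (Phi c y) i j) x).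

Definition nabla (Phi : tfield M 4) (k : nat) (S : tfield M k) (c : chart M)
    (x : 'rV[R]_8) (m : 'I_8) (s : k.-tuple 'I_8) : R :=
  'D_('e_m) (fun y => S c y s) x -
  \sum_(r < k) \sum_(p < 8) christoffel Phi c x p m (tnth s r) *
    S c x [tuple if q == r then p else tnth s q | q < k].

Definition is_torsion (Phi : tfield M 4) (T : tfield M 3) : Prop :=
  forall c x, chart_image c x -> forall m : 'I_8,
    let Tm : tensor R 2 := fun s => T c x [tuple of m :: s] in
    Omega2_7 (Phi c x) Tm /\
    forall i j k l, nabla Phi Phi c x m [tuple i; j; k; l] =
                    diamond (Phi c x) Tm i j k l.

End Fields.

(* Main.v *)
(** In a chart let g be the metric, G its inverse and A = h + X, and let a matrix B
    act on forms by the derivation [der B]. The evolution equation says that the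
    time derivative of Phi is [der (A G) Phi], and the torsion is characterised by
    [nabla_m Phi = der (T_m G) Phi] with T_m in Omega^2_7. Comparing with a curve of
    coframes having the same velocity shows g' = A + A^T = 2 h, which gives the
    variation of the Christoffel symbols. Put E = T_m' - A G T_m - T_m G A^T and let S
    be the argument of pi_7. Differentiating the equation for nabla_m Phi and using
    that [der] turns commutators of matrices into commutators of derivations, all
    terms cancel except [der ((E - S) G) Phi = 0], so E - S is in Omega^2_21;
    differentiating the linear equation defining Omega^2_7 along T_m shows that E is
    in Omega^2_7. Hence E = pi_7 S.

    The metric is defined through an arbitrary choice of coframe e, so its smoothness
    has to be established: Phi /\ Phi gives det e, a cubic contraction of Phi with the
    Levi-Civita symbol gives the 2 by 2 minors of g times det e, and g is recovered
    from the cofactors of its 3 by 3 principal submatrices by extracting a square root. *)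

Require Import Defs.
From HB Require Import structures.
From mathcomp Require Import all_boot all_order all_algebra all_fingroup.
From mathcomp Require Import all_classical all_reals all_analysis.
From mathcomp Require Import ring lra.
Set Implicit Arguments.
Unset Strict Implicit.
Unset Printing Implicit Defensive.
Import Order.TTheory GRing.Theory Num.Theory.
Import numFieldNormedType.Exports.
Local Open Scope classical_set_scope.
Local Open Scope ring_scope.

(** * The model form *)

(** The representation theory of Spin(7) is replaced by identities of the model form over finitely
    many index words (antisymmetry, self-duality, the double contraction), which are checked by
    evaluation and then transported along a coframe. No splitting of the 2-forms is constructed:
    contracting [der (B G) phi] with phi over three indices gives 24 B - 12 C, where C is the
    contraction of B with phi. This is 96 B on Omega^2_7, where C = -6 B, and 0 on Omega^2_21, where
    C = 2 B. One formula thus yields the kernel of the action and recovers T from nabla Phi, whence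
    T is differentiable in t. The obstacle is that the admissible forms are not open among all
    4-forms (their orbit has dimension 64 - 21 = 43 in a space of dimension 70), so functions of Phi
    are not differentiated on an open set of tensors. They are written as explicit expressions in
    the components of Phi, valid on the orbit, and differentiated along curves that stay in it. *)

Fixpoint delta (r s : seq nat) : int :=
  if r is x :: r' then
    foldr (fun j z => if x == nth 0%N s j then
        (if odd j then - delta r' (take j s ++ drop j.+1 s)
         else delta r' (take j s ++ drop j.+1 s)) + z else z) 0 (iota 0 (size s))
  else 1.

(* The components of [spin7_form 1], with indices in 0, .., 7. *)
Definition std (s : seq nat) : int :=
  - (delta [:: 0; 1; 2; 3]%N s + delta [:: 0; 1; 4; 5]%N s + delta [:: 0; 1; 6; 7]%N s
     + delta [:: 2; 3; 4; 5]%N s + delta [:: 2; 3; 6; 7]%N s + delta [:: 4; 5; 6; 7]%N s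
     + delta [:: 0; 2; 4; 6]%N s - delta [:: 0; 2; 5; 7]%N s - delta [:: 0; 3; 4; 7]%N s
     - delta [:: 0; 3; 5; 6]%N s - delta [:: 1; 2; 4; 7]%N s - delta [:: 1; 2; 5; 6]%N s
     - delta [:: 1; 3; 4; 6]%N s + delta [:: 1; 3; 5; 7]%N s)%R.

Fixpoint words (n : nat) : seq (seq nat) :=
  if n is n'.+1 then [seq x :: s | x <- iota 0 8, s <- words n'] else [:: [::]].

Definition kron (i j : nat) : int := (i == j)%:R.

(** Only 336 of the 4096 components of the model form are nonzero; listing them once keeps the
    exhaustive checks within reach of evaluation. *)
Definition tabulate (g : seq nat -> int) (l : seq (seq nat)) := [seq (w, g w) | w <- l & g w != 0].

(* Repeated indices are skipped because both sides vanish there. *)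
Lemma std_selfdual_check :
  let table := tabulate std (words 4) in
  all (fun s => if uniq s then
         foldr (fun p z => if has (mem s) p.1 then z
                           else p.2 * delta (iota 0 8) (p.1 ++ s) + z) 0 table == 24 * std s
       else std s == 0) (words 4).
Proof. vm_cast_no_check (erefl true). Qed.

Lemma std_contract_check :
  all (fun v => let row := tabulate (fun w => std (v ++ w)) (words 2) in
    all (fun u => foldr (fun p z => p.2 * std (u ++ p.1) + z) 0 row ==
      6 * kron (nth 0%N v 0) (nth 0%N u 0) * kron (nth 0%N v 1) (nth 0%N u 1)
      - 6 * kron (nth 0%N v 0) (nth 0%N u 1) * kron (nth 0%N v 1) (nth 0%N u 0)
      - 4 * std (v ++ u)) (words 2)) (words 2).
Proof. vm_cast_no_check (erefl true). Qed.

Lemma size_words n w : w \in words n -> size w = n.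
Proof.
elim: n w => [|n IH] w; first by rewrite inE => /eqP ->.
by case/allpairsP=> -[a b] [_ /IH /= bn ->]; rewrite /= bn.
Qed.

(** The recursion of [delta] is the Laplace expansion along the first row, restricted to the columns
    where the entry is 1; so [delta] is the generalised Kronecker symbol. *)
Lemma det_delta (R : comNzRingType) n (r s : seq nat) :
  size r = n -> size s = n ->
  \det (\matrix_(i < n, j < n) ((nth 0 r i == nth 0 s j)%N%:R : R)) = (delta r s)%:~R.
Proof.
elim: n r s => [|n IH] [|x r] s //; first by move=> _ _; rewrite det_mx00.
move=> [sr] ss; rewrite (expand_det_row _ ord0).
transitivity (\sum_(j < n.+1) ((x == nth 0%N s j)%:R * (-1) ^+ j *
    (delta r (take j s ++ drop j.+1 s))%:~R : R)).
  apply: eq_bigr => j _; rewrite mxE /= /cofactor add0n mulrA; congr (_ * _).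
  rewrite -IH //; last first.
    by rewrite size_cat size_take size_drop ss ltn_ord subSS subnKC // -ltnS.
  congr (\det _); apply/matrixP => i k; rewrite !mxE /=.
  rewrite nth_cat size_take ss ltn_ord /=.
  case: (ltnP k j) => kj; first by rewrite nth_take // /bump leqNgt kj.
  by rewrite /bump kj nth_drop addSn subnKC.
rewrite -(big_mkord predT (fun j => (x == nth 0%N s j)%:R * (-1) ^+ j *
    (delta r (take j s ++ drop j.+1 s))%:~R : R)) /= ss /index_iota subn0.
elim: (iota 0 n.+1) => [|j t IHt] /=; first by rewrite big_nil.
rewrite big_cons IHt; case: eqP => _ /=; last by rewrite !mul0r add0r.
by rewrite -signr_odd; case: (odd j); rewrite /= rmorphD ?rmorphN /= ?expr1 ?expr0
  ?mul1r ?mulN1r ?mulr1.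
Qed.

Lemma sum_tupleS (T : finType) (V : nmodType) n (F : n.+1.-tuple T -> V) :
  \sum_t F t = \sum_x \sum_(t : n.-tuple T) F [tuple of x :: t].
Proof.
rewrite pair_big /=.
rewrite (reindex (fun p : T * n.-tuple T => [tuple of p.1 :: p.2])) //=.
exists (fun t : n.+1.-tuple T => (thead t, [tuple of behead t])).
  by move=> [x t] _ /=; rewrite theadE; congr pair; apply: val_inj.
by move=> t _; rewrite -tuple_eta.
Qed.

Lemma sum_tuple0 (T : finType) (V : nmodType) (F : 0.-tuple T -> V) :
  \sum_t F t = F [tuple].
Proof. by rewrite (big_pred1 [tuple]) // => t; apply/esym/eqP/val_inj/size0nil/size_tuple. Qed.

Lemma sum_tuple_cat (T : finType) (V : nmodType) m n (F : (m + n).-tuple T -> V) :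
  \sum_t F t = \sum_(a : m.-tuple T) \sum_(b : n.-tuple T) F [tuple of a ++ b].
Proof.
elim: m F => [|m IH] F.
  rewrite sum_tuple0; apply: eq_bigr => b _; congr F; exact: val_inj.
rewrite sum_tupleS [RHS]sum_tupleS; apply: eq_bigr => x _.
rewrite (IH (fun t => F [tuple of x :: t])).
apply: eq_bigr => a _; apply: eq_bigr => b _; congr F; exact: val_inj.
Qed.

Lemma sum_words (V : nmodType) n (F : seq nat -> V) :
  \sum_(t : n.-tuple 'I_8) F (map val t) = \sum_(s <- words n) F s.
Proof.
elim: n F => [|n IH] F; first by rewrite sum_tuple0 big_seq1.
rewrite sum_tupleS [RHS]big_allpairs_dep /=.
rewrite -[LHS](big_mkord predT (fun x => \sum_(t : n.-tuple 'I_8) F (x :: map val t))) /=.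
by apply: eq_bigr => x _; rewrite (IH (fun s => F (x :: s))).
Qed.

Lemma mem_words n (t : n.-tuple 'I_8) : map val t \in words n.
Proof.
elim: n t => [|n IH] t; first by rewrite tuple0.
rewrite (tuple_eta t); apply/allpairsP; exists (val (thead t), map val (behead t)) => /=.
by split=> //; rewrite (mem_iota 0 8) ltn_ord.
Qed.

Lemma delta_not_uniq (s : seq nat) : size s = 8 -> ~~ uniq s -> delta (iota 0 8) s = 0.
Proof.
move=> s8 /(uniqPn 0%N)[i [j [ij js sij]]].
rewrite -[LHS]intz -(@det_delta int 8) ?size_iota // -det_tr.
rewrite s8 in js; apply: (@determinant_alternate _ _ _ (Ordinal (ltn_trans ij js)) (Ordinal js)).
  by rewrite -val_eqE /= neq_ltn ij.
by move=> k; rewrite !mxE /= sij.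
Qed.

Lemma foldr_support (g h : seq nat -> int) (l : seq (seq nat)) :
  foldr (fun p z => p.2 * h p.1 + z) 0 (tabulate g l) = \sum_(x <- l) g x * h x.
Proof.
rewrite /tabulate; elim: l => [|x l IH]; first by rewrite big_nil.
by rewrite big_cons -IH /=; case: (eqVneq (g x) 0) => [->|_] //; rewrite mul0r add0r.
Qed.

Lemma foldr_skip (T : eqType) (c : pred T) (h : T -> int) (l : seq T) :
  {in l, forall x, c x -> h x = 0} ->
  foldr (fun x z => if c x then z else h x + z) 0 l = foldr (fun x z => h x + z) 0 l.
Proof.
elim: l => //= x l IH h0; rewrite IH; last by move=> y yl; apply: h0; rewrite inE yl orbT.
by case: ifP => // /h0 ->; rewrite ?add0r ?inE ?eqxx.
Qed.

Arguments delta : simpl never.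
Arguments std : simpl never.
Arguments words : simpl never.
Arguments tabulate : simpl never.

(** Recorded as an equation because [std] is made opaque right after, which keeps simplification and
    unification from expanding it. *)
Lemma stdE s : std s =
  - (delta [:: 0; 1; 2; 3]%N s + delta [:: 0; 1; 4; 5]%N s + delta [:: 0; 1; 6; 7]%N s
     + delta [:: 2; 3; 4; 5]%N s + delta [:: 2; 3; 6; 7]%N s + delta [:: 4; 5; 6; 7]%N s
     + delta [:: 0; 2; 4; 6]%N s - delta [:: 0; 2; 5; 7]%N s - delta [:: 0; 3; 4; 7]%N s
     - delta [:: 0; 3; 5; 6]%N s - delta [:: 1; 2; 4; 7]%N s - delta [:: 1; 2; 5; 6]%N s
     - delta [:: 1; 3; 4; 6]%N s + delta [:: 1; 3; 5; 7]%N s).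
Proof. by []. Qed.
Opaque std delta.

Section Std.
Variable R : comNzRingType.
Definition stdr (s : 4.-tuple 'I_8) : R := (std (map val s))%:~R.
Definition levi (s : 8.-tuple 'I_8) : R := (delta (iota 0 8) (map val s))%:~R.

Lemma leviE s : levi s = \det (\matrix_(i, j) (i == tnth s j)%:R).
Proof.
rewrite /levi -(@det_delta R 8) ?size_map ?size_tuple //.
congr (\det _); apply/matrixP => i j; rewrite !mxE.
by rewrite (nth_map ord0) ?size_tuple // -tnth_nth nth_iota.
Qed.

Lemma std_selfdual (s : 4.-tuple 'I_8) :
  \sum_(a : 4.-tuple 'I_8) stdr a * levi [tuple of a ++ s] = 24 * stdr s.
Proof.
have E : \sum_(w <- words 4) std w * delta (iota 0 8) (w ++ map val s) =
         24 * std (map val s).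
  have /allP/(_ _ (mem_words s)) := std_selfdual_check.
  case: ifP => [us /eqP <-|us /eqP ->]; last first.
    rewrite mulr0 big_seq big1 // => w /size_words w4.
    rewrite delta_not_uniq ?mulr0 //; first by rewrite size_cat size_map size_tuple w4.
    by rewrite cat_uniq us !andbF.
  rewrite -(foldr_support std (fun w => delta (iota 0 8) (w ++ map val s))); apply/esym.
  apply: (foldr_skip (c := fun p => has (mem (map val s)) p.1)
    (h := fun p => p.2 * delta (iota 0 8) (p.1 ++ map val s))) => p.
  case/mapP=> w; rewrite mem_filter => /andP[_ /size_words w4] -> /= sw.
  rewrite delta_not_uniq ?mulr0 //; first by rewrite size_cat size_map size_tuple w4.
  by rewrite cat_uniq has_sym sw andbF.
rewrite -(sum_words 4 (fun w => std w * delta (iota 0 8) (w ++ map val s))) in E.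
have <- : (24 * std (map val s))%:~R = 24 * stdr s by rewrite intrM.
rewrite -E mulrz_sumr; apply: eq_bigr => a _.
by rewrite /levi map_cat intrM.
Qed.

Lemma std_contract (i j a b : 'I_8) :
  \sum_k \sum_l stdr [tuple i; j; k; l] * stdr [tuple a; b; k; l] =
  6 * (i == a)%:R * (j == b)%:R - 6 * (i == b)%:R * (j == a)%:R - 4 * stdr [tuple i; j; a; b].
Proof.
pose F w := std ([:: val i; val j] ++ w) * std ([:: val a; val b] ++ w).
have E : \sum_(w <- words 2) F w =
   6 * kron i a * kron j b - 6 * kron i b * kron j a - 4 * std [:: val i; val j; val a; val b].
  have /allP/(_ _ (mem_words [tuple i; j]))/allP/(_ _ (mem_words [tuple a; b]))/eqP <- :=
    std_contract_check.
  exact/esym/(foldr_support (fun w => std ([:: val i; val j] ++ w))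
               (fun w => std ([:: val a; val b] ++ w))).
rewrite -(sum_words 2 F) in E.
transitivity ((6 * kron i a * kron j b - 6 * kron i b * kron j a -
               4 * std [:: val i; val j; val a; val b])%:~R : R); last first.
  by rewrite !intrB !intrM /kron !mulrz_nat.
rewrite -E mulrz_sumr sum_tupleS; apply: eq_bigr => k _; rewrite sum_tupleS.
by apply: eq_bigr => l _; rewrite sum_tuple0 intrM.
Qed.
End Std.

(** Multilinearity in the columns, without collecting terms: the components of a wedge product of
    rows of [e] become the pullback by [e] of a Kronecker symbol. *)
Lemma det_cols (R : comNzRingType) n (e : 'M[R]_8) (r : 'I_n -> 'I_8) (s : n.-tuple 'I_8) :
  \det (\matrix_(i, j) e (r i) (tnth s j)) =
  \sum_(f : n.-tuple 'I_8) (\prod_q e (tnth f q) (tnth s q)) *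
     \det (\matrix_(i, j) (r i == tnth f j)%:R).
Proof.
rewrite -det_tr {1}/determinant.
transitivity (\sum_(w : 'S_n) \sum_(f : n.-tuple 'I_8) (-1) ^+ w *
   \prod_q ((r (w q) == tnth f q)%:R * e (tnth f q) (tnth s q))).
  apply: eq_bigr => w _; rewrite -big_distrr /=; congr (_ * _).
  transitivity (\prod_q \sum_x ((r (w q) == x)%:R * e x (tnth s q))).
    apply: eq_bigr => q _; rewrite !mxE (bigD1 (r (w q))) //= eqxx mul1r big1 ?addr0 // => x.
    by rewrite eq_sym => /negPf ->; rewrite mul0r.
  rewrite (bigA_distr_bigA (fun q x => (r (w q) == x)%:R * e x (tnth s q))) /=.
  rewrite (reindex (fun f : n.-tuple 'I_8 => [ffun q => tnth f q])) /=.
    by apply: eq_bigr => f _; apply: eq_bigr => q _; rewrite ffunE.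
  exists (fun f : {ffun 'I_n -> 'I_8} => [tuple f q | q < n]) => f _.
    by apply: eq_from_tnth => q; rewrite tnth_mktuple ffunE.
  by apply/ffunP => q; rewrite ffunE tnth_mktuple.
rewrite exchange_big; apply: eq_bigr => f _; rewrite -det_tr /determinant big_distrr /=.
apply: eq_bigr => w _; rewrite big_split /= mulrA [RHS]mulrC; congr (_ * _ * _).
by apply: eq_bigr => q _; rewrite !mxE.
Qed.

Lemma det_rows (R : comNzRingType) (e : 'M[R]_8) (s : 8.-tuple 'I_8) :
  \det (\matrix_(i, j) e (tnth s i) j) = levi R s * \det e.
Proof.
rewrite leviE -[X in X * _]det_tr -det_mulmx; congr (\det _).
apply/matrixP => i j; rewrite !mxE (bigD1 (tnth s i)) //= !mxE eqxx mul1r big1 ?addr0 // => x.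
by rewrite !mxE => /negPf ->; rewrite mul0r.
Qed.

Lemma spin7_formE (R : realType) (e : 'M[R]_8) (s : 4.-tuple 'I_8) :
  spin7_form e s = \sum_(f : 4.-tuple 'I_8) (\prod_q e (tnth f q) (tnth s q)) * stdr R f.
Proof.
have E i j k l : (0 < i <= 8)%N -> (0 < j <= 8)%N -> (0 < k <= 8)%N -> (0 < l <= 8)%N ->
  e4 e i j k l s = \sum_(f : 4.-tuple 'I_8) (\prod_q e (tnth f q) (tnth s q)) *
     (delta [:: i.-1; j.-1; k.-1; l.-1] (map val f))%:~R.
  move=> hi hj hk hl; rewrite /e4 det_cols; apply: eq_bigr => f _; congr (_ * _).
  rewrite -(@det_delta R 4) ?size_map ?size_tuple //.
  congr (\det _); apply/matrixP => a b; rewrite !mxE (nth_map ord0) ?size_tuple // -tnth_nth.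
  congr (nat_of_bool _)%:R; rewrite -val_eqE /=; congr (_ == _); rewrite inordK.
    by case: a => -[|[|[|[|]]]].
  by case: a => -[|[|[|[|]]]] //= _; rewrite prednK;
    move: hi hj hk hl => /andP[? ?] /andP[? ?] /andP[? ?] /andP[? ?].
(* The common sum is hidden behind an existential, so that the fourteen terms combine by its
   linearity alone. *)
have [S [SE SD SN]] : exists S : (seq nat -> int) -> R,
  [/\ forall g, S g = \sum_(f : 4.-tuple 'I_8)
                     (\prod_q e (tnth f q) (tnth s q)) * (g (map val f))%:~R,
      forall g h, S g + S h = S (fun w => g w + h w) &
      forall g, - S g = S (fun w => - g w)].
  eexists; split=> [g|g h|g]; first reflexivity.
    by rewrite -big_split; apply: eq_bigr => f _ /=; rewrite intrD mulrDr.
  by rewrite -sumrN; apply: eq_bigr => f _ /=; rewrite mulrNz mulrN.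
have SS a b c d f g h i j k l m n o : - (S a + S b + S c + S d + S f + S g + S h - S i - S j - S k - S l - S m - S n + S o) =
    S (fun w => - (a w + b w + c w + d w + f w + g w + h w - i w - j w - k w - l w - m w - n w + o w)) by rewrite !(SN, SD).
have {}E i j k l : (0 < i <= 8)%N -> (0 < j <= 8)%N -> (0 < k <= 8)%N -> (0 < l <= 8)%N ->
  e4 e i j k l s = S (delta [:: i.-1; j.-1; k.-1; l.-1]) by rewrite SE; apply: E.
rewrite /spin7_form !E; try by [].
rewrite SS SE; apply: eq_bigr => f _.
by rewrite /stdr stdE.
Qed.

(** * Pullbacks and derivations *)

Lemma tuple4_eta (s : 4.-tuple 'I_8) : exists i j k l, s = [tuple i; j; k; l].
Proof.
exists (nth ord0 s 0), (nth ord0 s 1), (nth ord0 s 2), (nth ord0 s 3).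
by apply: eq_from_tnth => -[[|[|[|[|//]]]] ?]; rewrite (tnth_nth ord0).
Qed.

Section Action.
Variable R : comNzRingType.
Implicit Types (e f B C : 'M[R]_8).

Lemma prod_sum_tuple (T : finType) n (F : 'I_n -> T -> R) :
  \prod_q \sum_x F q x = \sum_(t : n.-tuple T) \prod_q F q (tnth t q).
Proof.
rewrite bigA_distr_bigA /=.
rewrite (reindex (fun t : n.-tuple T => [ffun q => tnth t q])) /=.
  by apply: eq_bigr => t _; apply: eq_bigr => q _; rewrite ffunE.
exists (fun t : {ffun 'I_n -> T} => [tuple t q | q < n]) => t _.
  by apply: eq_from_tnth => q; rewrite tnth_mktuple ffunE.
by apply/ffunP => q; rewrite ffunE tnth_mktuple.
Qed.

(** Pullback along the linear map with matrix [e]; by [spin7_formE] an adapted coframe exhibits the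
    form as the pullback of the model. *)
Definition pull n e (F : n.-tuple 'I_8 -> R) (s : n.-tuple 'I_8) : R :=
  \sum_(t : n.-tuple 'I_8) (\prod_q e (tnth t q) (tnth s q)) * F t.

Lemma sum_prod_mx n e f (s t : n.-tuple 'I_8) :
  \sum_(u : n.-tuple 'I_8) (\prod_q e (tnth s q) (tnth u q)) * (\prod_q f (tnth u q) (tnth t q)) =
  \prod_q (e *m f) (tnth s q) (tnth t q).
Proof.
transitivity (\prod_q \sum_x e (tnth s q) x * f x (tnth t q)).
  by rewrite prod_sum_tuple; apply: eq_bigr => u _; rewrite -big_split.
by apply: eq_bigr => q _; rewrite mxE.
Qed.

Lemma prod_mx1 n (s t : n.-tuple 'I_8) :
  \prod_q (1%:M : 'M[R]_8) (tnth s q) (tnth t q) = (s == t)%:R.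
Proof.
have [->|st] := eqVneq s t; first by apply: big1 => q _; rewrite mxE eqxx.
have [q sq] : exists q, tnth s q != tnth t q.
  apply/existsP; apply: contraNT st => /existsPn st; apply/eqP/eq_from_tnth => q.
  by have := st q; rewrite negbK => /eqP.
by rewrite (bigD1 q) //= mxE (negPf sq) mul0r.
Qed.

Lemma pull_comp n e f (F : n.-tuple 'I_8 -> R) s : pull f (pull e F) s = pull (e *m f) F s.
Proof.
rewrite /pull; under eq_bigr => t _ do rewrite big_distrr /=.
rewrite exchange_big; apply: eq_bigr => u _ /=; rewrite -sum_prod_mx big_distrl /=.
by apply: eq_bigr => t _; rewrite mulrCA mulrA.
Qed.

Lemma sum_delta (T : finType) (F : T -> R) s : \sum_t (t == s)%:R * F t = F s.
Proof.
rewrite (bigD1 s) //= eqxx mul1r big1 ?addr0 // => t /negPf ->.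
by rewrite mul0r.
Qed.

Lemma pull1 n (F : n.-tuple 'I_8 -> R) s : pull 1%:M F s = F s.
Proof. by rewrite /pull; under eq_bigr => t _ do rewrite prod_mx1; rewrite sum_delta. Qed.

Lemma prod_cat (F : 'I_8 -> 'I_8 -> R) m n (a c : m.-tuple 'I_8) (b d : n.-tuple 'I_8) :
  \prod_q F (tnth [tuple of a ++ b] q) (tnth [tuple of c ++ d] q) =
  (\prod_q F (tnth a q) (tnth c q)) * \prod_q F (tnth b q) (tnth d q).
Proof.
rewrite big_split_ord /=; congr (_ * _); apply: eq_bigr => q _.
  by rewrite !tnth_lshift.
by rewrite !tnth_rshift.
Qed.

Lemma pull_cat m n e (F : (m + n).-tuple 'I_8 -> R) (a : m.-tuple 'I_8) (b : n.-tuple 'I_8) :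
  pull e F [tuple of a ++ b] = \sum_(c : m.-tuple 'I_8) \sum_(d : n.-tuple 'I_8)
    (\prod_q e (tnth c q) (tnth a q)) * (\prod_q e (tnth d q) (tnth b q)) * F [tuple of c ++ d].
Proof.
rewrite /pull sum_tuple_cat; apply: eq_bigr => c _; apply: eq_bigr => d _.
by rewrite prod_cat.
Qed.

Definition upd n (s : n.-tuple 'I_8) (r : 'I_n) (p : 'I_8) : n.-tuple 'I_8 :=
  [tuple if q == r then p else tnth s q | q < n].

Lemma upd_self n (s : n.-tuple 'I_8) r p q : upd (upd s r p) r q = upd s r q.
Proof. by apply: eq_from_tnth => i; rewrite !tnth_mktuple; case: eqP. Qed.

Lemma upd_comm n (s : n.-tuple 'I_8) r r' p q : r != r' ->
  upd (upd s r p) r' q = upd (upd s r' q) r p.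
Proof.
move=> rr'; apply: eq_from_tnth => i; rewrite !tnth_mktuple.
by case: eqP => // ->; rewrite eq_sym (negPf rr').
Qed.

Lemma upd_id n (s : n.-tuple 'I_8) r : upd s r (tnth s r) = s.
Proof. by apply: eq_from_tnth => i; rewrite !tnth_mktuple; case: eqP => // ->. Qed.

Lemma tnth_upd n (s : n.-tuple 'I_8) r p q : tnth (upd s r p) q = if q == r then p else tnth s q.
Proof. by rewrite tnth_mktuple. Qed.

Definition der n B (F : n.-tuple 'I_8 -> R) (s : n.-tuple 'I_8) : R :=
  \sum_r \sum_p B (tnth s r) p * F (upd s r p).

Lemma eq_der n B (F F' : n.-tuple 'I_8 -> R) : F =1 F' -> der B F =1 der B F'.
Proof. by move=> E s; apply: eq_bigr => r _; apply: eq_bigr => p _; rewrite E. Qed.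

Lemma derDl n B C (F : n.-tuple 'I_8 -> R) s : der (B + C) F s = der B F s + der C F s.
Proof.
rewrite /der -big_split; apply: eq_bigr => r _; rewrite -big_split; apply: eq_bigr => p _.
by rewrite mxE mulrDl.
Qed.

Lemma derNl n B (F : n.-tuple 'I_8 -> R) s : der (- B) F s = - der B F s.
Proof.
rewrite /der -sumrN; apply: eq_bigr => r _; rewrite -sumrN; apply: eq_bigr => p _.
by rewrite mxE mulNr.
Qed.

Lemma derB n B (F F' : n.-tuple 'I_8 -> R) s :
  der B (fun s => F s - F' s) s = der B F s - der B F' s.
Proof.
rewrite /der -sumrB; apply: eq_bigr => r _; rewrite -sumrB; apply: eq_bigr => p _.
by rewrite mulrBr.
Qed.

(* In [der B (der C F)] the terms acting on two different slots are symmetric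
   in [B] and [C]; those acting twice on the same slot give [B *m C]. *)
Lemma der_comm n B C (F : n.-tuple 'I_8 -> R) s :
  der B (der C F) s - der C (der B F) s = der (B *m C - C *m B) F s.
Proof.
pose off B C := \sum_r \sum_(r' | r' != r) \sum_p \sum_q
  B (tnth s r) p * C (tnth s r') q * F (upd (upd s r p) r' q).
have E B' C' : der B' (der C' F) s = der (B' *m C') F s + off B' C'.
  rewrite /der /off -big_split; apply: eq_bigr => r _ /=.
  under eq_bigr => p _ do rewrite big_distrr (bigD1 r) //=.
  rewrite big_split /=; congr (_ + _).
    under eq_bigr => p _ do rewrite big_distrr /=.
    rewrite exchange_big; apply: eq_bigr => q _ /=; rewrite mxE big_distrl /=.
    by apply: eq_bigr => p _; rewrite upd_self tnth_upd eqxx mulrA.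
  rewrite exchange_big; apply: eq_bigr => r' rr' /=; apply: eq_bigr => p _.
  rewrite big_distrr; apply: eq_bigr => q _ /=.
  by rewrite mulrA tnth_upd (negPf rr').
rewrite E (E C B); have -> : off B C = off C B; last by rewrite derDl derNl; ring.
rewrite /off (exchange_big_dep predT) //=; apply: eq_bigr => r' _.
apply: eq_big => [r|r rr']; first by rewrite eq_sym.
rewrite exchange_big; apply: eq_bigr => q _; apply: eq_bigr => p _ /=.
by rewrite (mulrC (B _ _)) upd_comm // eq_sym.
Qed.

Lemma der_pullE n B e (F : n.-tuple 'I_8 -> R) s :
  der B (pull e F) s = \sum_(t : n.-tuple 'I_8)
    (\sum_r (B *m e^T) (tnth s r) (tnth t r) * \prod_(q | q != r) e (tnth t q) (tnth s q)) * F t.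
Proof.
under [RHS]eq_bigr => t _ do rewrite mulr_suml.
rewrite exchange_big; apply: eq_bigr => r _ /=.
under eq_bigr => p _ do rewrite /pull big_distrr /=.
rewrite exchange_big; apply: eq_bigr => t _ /=; rewrite mxE !big_distrl /=.
apply: eq_bigr => p _; rewrite (bigD1 r) //= tnth_upd eqxx !mulrA mxE; congr (_ * _ * _).
by apply: eq_bigr => q qr; rewrite tnth_upd (negPf qr).
Qed.

(** Both sides are sums over one distinguished slot, in which B e^T and e^T C can be exchanged. This
    carries computations in coordinates to the adapted frame. *)
Lemma der_pull n e B C (F : n.-tuple 'I_8 -> R) s :
  B *m e^T = e^T *m C -> der B (pull e F) s = pull e (der C F) s.
Proof.
move=> BC; rewrite der_pullE BC /pull /der.
under eq_bigr => t _ do rewrite mulr_suml.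
rewrite exchange_big /=; under [RHS]eq_bigr => t _ do rewrite big_distrr /=.
rewrite [RHS]exchange_big; apply: eq_bigr => r _ /=.
transitivity (\sum_(t : n.-tuple 'I_8) \sum_p
   e p (tnth s r) * C p (tnth t r) * (\prod_(q | q != r) e (tnth t q) (tnth s q)) * F t).
  by apply: eq_bigr => t _; rewrite mxE !big_distrl; apply: eq_bigr => p _; rewrite /= !mxE.
under [RHS]eq_bigr => t _ do rewrite big_distrr /=.
rewrite !pair_big /=.
(* The involution that swaps the entry in slot r with the summation index. *)
rewrite (reindex (fun v : n.-tuple 'I_8 * 'I_8 => (upd v.1 r v.2, tnth v.1 r))) /=.
  apply: eq_bigr => -[t p] _ /=; rewrite tnth_upd eqxx (bigD1 r (F := fun q => e (tnth t q) _)) //=.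
  rewrite -!mulrA; congr (_ * _); rewrite mulrCA; congr (_ * (_ * _)).
  by apply: eq_bigr => q qr; rewrite tnth_upd (negPf qr).
have K : cancel (fun v : n.-tuple 'I_8 * 'I_8 => (upd v.1 r v.2, tnth v.1 r))
                (fun v : n.-tuple 'I_8 * 'I_8 => (upd v.1 r v.2, tnth v.1 r)).
  by move=> [t p] /=; rewrite upd_self upd_id tnth_upd eqxx.
by exists (fun v : n.-tuple 'I_8 * 'I_8 => (upd v.1 r v.2, tnth v.1 r)) => v _; rewrite K.
Qed.
End Action.

(** * The Hodge star of the product with the form *)

Definition permt n (w : 'S_n) (a : n.-tuple 'I_8) : n.-tuple 'I_8 :=
  [tuple tnth a (w i) | i < n].

Lemma permtK n (w : 'S_n) : cancel (permt w) (permt (w^-1)%g).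
Proof. by move=> a; apply: eq_from_tnth => i; rewrite !tnth_mktuple permKV. Qed.

Lemma permt_bij n (w : 'S_n) : bijective (permt w).
Proof.
exists (permt (w^-1)%g); first exact: permtK.
by move=> a; apply: eq_from_tnth => i; rewrite !tnth_mktuple permK.
Qed.

Lemma det_row_mx_col_perm (R : comNzRingType) m n (A : 'M[R]_(m + n, m))
    (B : 'M[R]_(m + n, n)) (w : 'S_m) :
  \det (row_mx (col_perm w A) B) = (-1) ^+ w * \det (row_mx A B).
Proof.
have -> : row_mx (col_perm w A) B =
          row_mx A B *m block_mx (perm_mx (w^-1)%g) 0 0 (1%:M : 'M[R]_n).
  by rewrite mul_row_block !mulmx0 mulmx1 addr0 add0r col_permE.
by rewrite det_mulmx det_ublock det1 mulr1 det_perm odd_permV mulrC.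
Qed.

(** Reindexing by w trades each sign for the sign of V, so the antisymmetrisation inside a wedge
    product becomes a factor m!. *)
Lemma sum_alternating (R : comNzRingType) m (F V : m.-tuple 'I_8 -> R) :
  (forall w a, V (permt w a) = (-1) ^+ (w : 'S_m) * V a) ->
  \sum_a (\sum_(w : 'S_m) (-1) ^+ w * F (permt w a)) * V a = m`!%:R * \sum_a F a * V a.
Proof.
move=> VA; under eq_bigr => a _ do rewrite big_distrl /=.
rewrite exchange_big -card_Sn -sum1_card natr_sum big_distrl /=; apply: eq_bigr => w _.
rewrite mul1r [RHS](reindex (permt w)) /=; last exact/onW_bij/permt_bij.
by apply: eq_bigr => a _; rewrite VA mulrCA mulrA.
Qed.

Section Hodge.
Variables (R : realType) (e : 'M[R]_8).
Hypothesis eU : e \in unitmx.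
Let G := invmx (e^T *m e).
Let f := invmx e.

Lemma inv_gram : G = f *m f^T.
Proof.
rewrite /G /f trmx_inv; apply: (invrM (_ : e^T \is a GRing.unit) eU).
by rewrite unitmxE det_tr -unitmxE.
Qed.

Lemma inv_gram_tr : G *m e^T = f.
Proof. by rewrite inv_gram -mulmxA -trmx_mul mulmxV // trmx1 mulmx1. Qed.

Definition vol (t : 8.-tuple 'I_8) : R := \det (\matrix_(i, j) e i (tnth t j)).

Lemma volE t : vol t = pull e (levi R) t.
Proof.
by rewrite /vol (det_cols e id); apply: eq_bigr => h _; rewrite leviE.
Qed.

Lemma vol_perm (w : 'S_6) (b : 6.-tuple 'I_8) (s : 2.-tuple 'I_8) :
  vol [tuple of permt w b ++ s] = (-1) ^+ w * vol [tuple of b ++ s].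
Proof.
have E (c : 6.-tuple 'I_8) : \matrix_(i, j) e i (tnth [tuple of c ++ s] j) =
   row_mx (\matrix_(i, j) e i (tnth c j)) (\matrix_(i, j) e i (tnth s j)) :> 'M[R]_(6 + 2).
  apply/matrixP => i j; rewrite mxE; case: (@split_ordP 6 2 j) => k ->.
    by rewrite row_mxEl mxE tnth_lshift.
  by rewrite row_mxEr mxE tnth_rshift.
rewrite /vol !E.
have -> : \matrix_(i < 8, j < 6) e i (tnth (permt w b) j) =
          col_perm w (\matrix_(i, j) e i (tnth b j)).
  by apply/matrixP => i j; rewrite !mxE tnth_mktuple.
exact: (@det_row_mx_col_perm _ 6 2).
Qed.

(** Up to the factor 1/6!, the kernel of the Hodge star from 6-forms to 2-forms: the volume form
    with six indices raised. *)
Let V (s : 2.-tuple 'I_8) (a : 6.-tuple 'I_8) :=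
  \sum_(b : 6.-tuple 'I_8) (\prod_r G (tnth a r) (tnth b r)) * vol [tuple of b ++ s].

Lemma V_perm s w a : V s (permt w a) = (-1) ^+ w * V s a.
Proof.
rewrite /V (reindex (permt w)) /=; last exact/onW_bij/permt_bij.
rewrite big_distrr; apply: eq_bigr => b _ /=; rewrite vol_perm mulrCA; congr (_ * (_ * _)).
rewrite [RHS](reindex_inj (@perm_inj _ w)) /=.
by apply: eq_bigr => r _; rewrite !tnth_mktuple.
Qed.

(** Since G e^T = f, raising the indices of a pullback by e leaves factors f, and the kernel in the
    coframe is the Levi-Civita symbol. *)
Lemma VE s a : V s a = \sum_(h : 6.-tuple 'I_8) \sum_(k : 2.-tuple 'I_8)
  (\prod_r f (tnth a r) (tnth h r)) * (\prod_q e (tnth k q) (tnth s q)) *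
  levi R [tuple of h ++ k].
Proof.
rewrite /V; under eq_bigr => b _.
  rewrite volE (@pull_cat _ 6 2) big_distrr /=.
  under eq_bigr => h _ do rewrite big_distrr /=.
  over.
rewrite exchange_big; apply: eq_bigr => h _ /=.
rewrite exchange_big; apply: eq_bigr => k _ /=.
rewrite -[in RHS]inv_gram_tr -sum_prod_mx !big_distrl; apply: eq_bigr => b _ /=.
rewrite !mulrA; congr (_ * _ * _ * _); apply: eq_bigr => r _; by rewrite mxE.
Qed.

(** In the adapted coframe the star contracts the Levi-Civita symbol with both factors; its
    contraction with the model form is given by [std_selfdual], and what remains is a contraction of
    b with phi. *)
Lemma hodge_wedge (phi : tensor R 4) (b : tensor R 2) s :
  (forall s, phi s = pull e (stdr R) s) ->
  @hodge R 6 2 (e^T *m e) vol (wedge phi b) s =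
  2^-1 * \sum_(c : 2.-tuple 'I_8) pull G b c * phi [tuple of c ++ s].
Proof.
move=> phiE.
pose F (a : 6.-tuple 'I_8) := phi [tuple tnth a (lshift 2 i) | i < 4] *
                              b [tuple tnth a (rshift 4 j) | j < 2].
have FE (a : 4.-tuple 'I_8) (c : 2.-tuple 'I_8) : F [tuple of a ++ c] = phi a * b c.
  rewrite /F; have -> : [tuple tnth [tuple of a ++ c] (lshift 2 i) | i < 4] = a.
    by apply: eq_from_tnth => i; rewrite tnth_mktuple tnth_lshift.
  have -> // : [tuple tnth [tuple of a ++ c] (rshift 4 i) | i < 2] = c.
  by apply: eq_from_tnth => i; rewrite tnth_mktuple tnth_rshift.
have -> : @hodge R 6 2 (e^T *m e) vol (wedge phi b) s =
    6`!%:R^-1 * ((4`! * 2`!)%:R^-1 *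
     \sum_a (\sum_(w : 'S_6) (-1) ^+ w * F (permt w a)) * V s a).
  rewrite /hodge; congr (_ * _); rewrite big_distrr; apply: eq_bigr => a _ /=.
  rewrite /V mulrA big_distrr; apply: eq_bigr => c _ /=.
  rewrite -mulrA; congr (_ * _); rewrite /wedge; congr (_ * _).
  apply: eq_bigr => w _; rewrite -mulrA /F; congr (_ * (_ * _)).
    by congr phi; apply: eq_from_tnth => i; rewrite !tnth_mktuple.
  by congr b; apply: eq_from_tnth => i; rewrite !tnth_mktuple.
rewrite (sum_alternating _ (V_perm s)).
have -> : \sum_a F a * V s a = 24 * \sum_(c : 2.-tuple 'I_8) pull G b c * phi [tuple of c ++ s].
  transitivity (\sum_(h : 2.-tuple 'I_8) \sum_(k : 2.-tuple 'I_8)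
     pull f b h * (\prod_q e (tnth k q) (tnth s q)) * (24 * stdr R [tuple of h ++ k])).
    transitivity (\sum_(h' : 4.-tuple 'I_8) \sum_(h : 2.-tuple 'I_8) \sum_(k : 2.-tuple 'I_8)
        pull f phi h' * pull f b h * (\prod_q e (tnth k q) (tnth s q)) *
        levi R [tuple of h' ++ [tuple of h ++ k]]).
      under eq_bigr => a _ do rewrite VE big_distrr /=.
      rewrite exchange_big (@sum_tuple_cat _ _ 4 2); apply: eq_bigr => h' _.
      apply: eq_bigr => h _; rewrite (@sum_tuple_cat _ _ 4 2) /=.
      under eq_bigr => a _.
        under eq_bigr => c _ do rewrite FE big_distrr /=.
        rewrite exchange_big; over.
      rewrite exchange_big; apply: eq_bigr => k _ /=.
      rewrite /pull !big_distrl; apply: eq_bigr => a _ /=.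
      rewrite big_distrr /= !big_distrl; apply: eq_bigr => c _ /=.
      have -> : \prod_(r < 6) f (tnth [tuple of a ++ c] r) (tnth [tuple of h' ++ h] r) =
          (\prod_q f (tnth a q) (tnth h' q)) * \prod_q f (tnth c q) (tnth h q) by exact: (@prod_cat _ (fun_of_matrix f) 4 2).
      have -> : levi R [tuple of [tuple of h' ++ h] ++ k] =
                levi R [tuple of h' ++ [tuple of h ++ k]].
        by congr levi; apply: val_inj; rewrite /= catA.
      have AC (x y z t u v : R) : x * y * (z * t * u * v) = z * x * (t * y) * u * v by ring.
      exact: AC.
    rewrite exchange_big; apply: eq_bigr => h _ /=.
    rewrite exchange_big; apply: eq_bigr => k _ /=.
    rewrite -std_selfdual big_distrr; apply: eq_bigr => h' _ /=.
    have AC (x y z t : R) : x * y * z * t = y * z * (x * t) by ring.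
    suff -> : pull f phi h' = stdr R h' by exact: AC.
    transitivity (pull f (pull e (stdr R)) h').
      by rewrite /pull; apply: eq_bigr => t _; rewrite phiE.
    by rewrite pull_comp mulmxV // pull1.
  rewrite big_distrr /=.
  under [RHS]eq_bigr => c _ do rewrite phiE (@pull_cat _ 2 2) !big_distrr /=.
  rewrite [RHS]exchange_big; apply: eq_bigr => h _ /=.
  under [RHS]eq_bigr => c _ do rewrite !big_distrr /=.
  rewrite [RHS]exchange_big; apply: eq_bigr => k _ /=.
  transitivity (pull e^T (pull G b) h * (\prod_q e (tnth k q) (tnth s q)) *
                (24 * stdr R [tuple of h ++ k])).
    by rewrite pull_comp inv_gram_tr.
  rewrite /pull !big_distrl; apply: eq_bigr => c _ /=.
  have -> : \prod_q e^T (tnth c q) (tnth h q) = \prod_q e (tnth h q) (tnth c q).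
    by apply: eq_bigr => q _; rewrite mxE.
  have AC (x y z t : R) : x * y * z * (24 * t) = 24 * (y * (x * z * t)) by ring.
  exact: AC.
set Z := \sum_(c : 2.-tuple 'I_8) _.
(* The constant is 24 / (4! 2!) = 1/2, the two factors 6! cancelling. *)
have -> : 6`!%:R = 720 :> R by [].
have -> : (4`! * 2`!)%:R = 48 :> R by [].
by field.
Qed.

End Hodge.

(** * Contractions *)

Lemma std_swap_check : all (fun w =>
  let i := nth 0%N w 0 in let j := nth 0%N w 1 in
  let k := nth 0%N w 2 in let l := nth 0%N w 3 in
  [&& std [:: j; i; k; l] == - std w, std [:: i; k; j; l] == - std w &
      std [:: i; j; l; k] == - std w]) (words 4).
Proof. vm_cast_no_check (erefl true). Qed.

Lemma eq_opp0 (R : numDomainType) (x : R) : x = - x -> x = 0.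
Proof. by move/esym/eqP; rewrite eqNr => /eqP. Qed.

Section Frame.
Variable R : realType.
Local Notation phi0 := (stdr R).

Lemma std_swap (i j k l : 'I_8) :
  [/\ phi0 [tuple j; i; k; l] = - phi0 [tuple i; j; k; l],
      phi0 [tuple i; k; j; l] = - phi0 [tuple i; j; k; l] &
      phi0 [tuple i; j; l; k] = - phi0 [tuple i; j; k; l]].
Proof.
have /allP/(_ _ (mem_words [tuple i; j; k; l]))/and3P[/eqP E1 /eqP E2 /eqP E3] := std_swap_check.
by split; rewrite /stdr -mulrNz; congr (_ %:~R); [exact: E1 | exact: E2 | exact: E3].
Qed.

Lemma std_swap12 i j k l : phi0 [tuple j; i; k; l] = - phi0 [tuple i; j; k; l].
Proof. by case: (std_swap i j k l). Qed.
Lemma std_swap23 i j k l : phi0 [tuple i; k; j; l] = - phi0 [tuple i; j; k; l].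
Proof. by case: (std_swap i j k l). Qed.
Lemma std_swap34 i j k l : phi0 [tuple i; j; l; k] = - phi0 [tuple i; j; k; l].
Proof. by case: (std_swap i j k l). Qed.

Opaque stdr.

Lemma derE4 (W : 'M[R]_8) (F : tensor R 4) i j k l : der W F [tuple i; j; k; l] =
  \sum_p W i p * F [tuple p; j; k; l] + \sum_p W j p * F [tuple i; p; k; l] +
  \sum_p W k p * F [tuple i; j; p; l] + \sum_p W l p * F [tuple i; j; k; p].
Proof.
have sum4 (h : 'I_4 -> R) : \sum_r h r =
    h ord0 + h (lift ord0 ord0) + h (lift ord0 (lift ord0 ord0)) +
    h (lift ord0 (lift ord0 (lift ord0 ord0))).
  by rewrite !big_ord_recl big_ord0 addr0 !addrA.
rewrite /der sum4; do !congr (_ + _); apply: eq_bigr => p _; congr (_ * F _);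
  by apply: eq_from_tnth => -[[|[|[|[|//]]]] ?]; rewrite tnth_upd.
Qed.

Lemma std_trace j p b : phi0 [tuple p; j; b; j] = 0.
Proof.
have E : phi0 [tuple p; b; j; j] = 0.
  by apply: eq_opp0; rewrite -std_swap34.
by rewrite std_swap23 E oppr0.
Qed.

Lemma sum_kron (F : 'I_8 -> R) b : \sum_p (p == b)%:R * F p = F b.
Proof. exact: sum_delta. Qed.

(** One more trace of [std_contract]: 42 = 6 * 8 - 6. *)
Lemma std_norm (p b : 'I_8) :
  \sum_j \sum_k \sum_l phi0 [tuple p; j; k; l] * phi0 [tuple b; j; k; l] = 42 * (p == b)%:R.
Proof.
under eq_bigr => j _ do rewrite std_contract std_trace eqxx mulr0 subr0 mulr1.
rewrite sumrB sumr_const card_ord.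
under eq_bigr => j _ do rewrite [_ * (j == b)%:R]mulrC.
by rewrite sum_kron -mulr_natr; set x := (p == b)%:R; ring.
Qed.

(** The slot i contributes 42 W by [std_norm]. Each of the other three slots contributes the same
    sum [Y], by renaming and antisymmetry; in [Y] the trace of W drops out and -6 W survives besides
    the contraction with phi. Hence 24 = 42 - 18 and 12 = 3 * 4. *)
Lemma frame_contract (W : 'M[R]_8) (i b : 'I_8) : W^T = - W ->
  \sum_j \sum_k \sum_l der W phi0 [tuple i; j; k; l] * phi0 [tuple b; j; k; l] =
  24 * W i b - 12 * \sum_j \sum_p W j p * phi0 [tuple j; p; i; b].
Proof.
move=> Wskew; have W0 j : W j j = 0.
  by have /matrixP/(_ j j) := Wskew; rewrite !mxE => /eq_opp0.
pose Y := \sum_j \sum_p W j p * \sum_k \sum_l phi0 [tuple i; p; k; l] * phi0 [tuple b; j; k; l].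
have YE : Y = - 6 * W i b - 4 * \sum_j \sum_p W j p * phi0 [tuple j; p; i; b].
  transitivity (\sum_j \sum_p (6 * (i == b)%:R * ((p == j)%:R * W j p)
      - 6 * ((p == b)%:R * ((j == i)%:R * W j p)) - 4 * (W j p * phi0 [tuple j; p; i; b]))).
    apply: eq_bigr => j _; apply: eq_bigr => p _; rewrite std_contract.
    rewrite (_ : phi0 [tuple i; p; b; j] = phi0 [tuple j; p; i; b]).
      have AC (x y z t u v : R) : x * (6 * y * z - 6 * t * u - 4 * v) =
        6 * y * (z * x) - 6 * (u * (t * x)) - 4 * (x * v) by ring.
      by rewrite (eq_sym i j); apply: AC.
    by rewrite std_swap34 std_swap23 opprK std_swap12 std_swap23 opprK.
  under eq_bigr => j _ do rewrite !sumrB -!mulr_sumr !sum_kron W0 mulr0 sub0r.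
  by rewrite sumrB -mulr_sumr sumrN -mulr_sumr sum_kron mulNr.
transitivity (\sum_p W i p * (\sum_j \sum_k \sum_l phi0 [tuple p; j; k; l] * phi0 [tuple b; j; k; l])
   + Y + Y + Y); last first.
  under eq_bigr => p _ do rewrite std_norm mulrC -mulrA mulrCA.
  rewrite YE sum_kron; set Z := \sum_j _; move: (W i b) Z => x z; ring.
under eq_bigr => j _.
  under eq_bigr => k _.
    under eq_bigr => l _ do rewrite derE4 !mulrDl.
    rewrite !big_split; over.
  rewrite !big_split; over.
rewrite !big_split; do !congr (_ + _).
- under [RHS]eq_bigr => p _ do rewrite big_distrr /=.
  rewrite [RHS]exchange_big; apply: eq_bigr => j _ /=.
  under [RHS]eq_bigr => p _ do rewrite big_distrr /=.
  rewrite [RHS]exchange_big; apply: eq_bigr => k _ /=.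
  under [RHS]eq_bigr => p _ do rewrite big_distrr /=.
  rewrite [RHS]exchange_big; apply: eq_bigr => l _ /=.
  by rewrite big_distrl; apply: eq_bigr => p _; rewrite mulrA.
- rewrite /Y; apply: eq_bigr => j _.
  under [RHS]eq_bigr => p _ do rewrite big_distrr /=.
  rewrite [RHS]exchange_big; apply: eq_bigr => k _ /=.
  under [RHS]eq_bigr => p _ do rewrite big_distrr /=.
  rewrite [RHS]exchange_big; apply: eq_bigr => l _ /=.
  by rewrite big_distrl; apply: eq_bigr => p _; rewrite mulrA.
- rewrite exchange_big /Y; apply: eq_bigr => k _.
  under [RHS]eq_bigr => p _ do rewrite big_distrr /=.
  rewrite [RHS]exchange_big; apply: eq_bigr => j _ /=.
  under [RHS]eq_bigr => p _ do rewrite big_distrr /=.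
  rewrite [RHS]exchange_big; apply: eq_bigr => l _ /=.
  rewrite big_distrl; apply: eq_bigr => p _ /=.
  by rewrite std_swap23 (std_swap23 b k j) !(mulrN, mulNr) opprK mulrA.
- under eq_bigr => j _ do rewrite exchange_big.
  rewrite exchange_big /Y; apply: eq_bigr => l _.
  under [RHS]eq_bigr => p _ do rewrite big_distrr /=.
  rewrite [RHS]exchange_big; apply: eq_bigr => j _ /=.
  under [RHS]eq_bigr => p _ do rewrite big_distrr /=.
  rewrite [RHS]exchange_big; apply: eq_bigr => k _ /=.
  rewrite big_distrl; apply: eq_bigr => p _ /=.
  rewrite std_swap34 std_swap23 opprK (std_swap34 b j l k) (std_swap23 b l j k) opprK.
  by rewrite mulrA.
Qed.
End Frame.

Section Coordinates.
Variables (R : realType) (e : 'M[R]_8) (phi : tensor R 4).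
Hypothesis eU : e \in unitmx.
Hypothesis phiE : forall s, phi s = pull e (stdr R) s.
Let G := invmx (e^T *m e).
Let f := invmx e.

Lemma pull_cons n (F : n.+1.-tuple 'I_8 -> R) i (t : n.-tuple 'I_8) :
  pull e F [tuple of i :: t] = \sum_x \sum_(h : n.-tuple 'I_8)
    e x i * (\prod_q e (tnth h q) (tnth t q)) * F [tuple of x :: h].
Proof.
rewrite /pull sum_tupleS; apply: eq_bigr => x _; apply: eq_bigr => h _.
congr (_ * _); rewrite big_ord_recl /=; congr (e _ _ * _).
by apply: eq_bigr => q _; rewrite !tnthS.
Qed.

Definition ctr3 (A : 'M[R]_8) (Z H : tensor R 4) (i b : 'I_8) : R :=
  \sum_(t : 3.-tuple 'I_8) \sum_(u : 3.-tuple 'I_8)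
    (\prod_r A (tnth t r) (tnth u r)) * Z [tuple of i :: t] * H [tuple of b :: u].

(** Because e G e^T = 1, raising indices with G after a pullback amounts to plain summation in the
    frame. *)
Lemma ctr3_pull (Z H : tensor R 4) i b : ctr3 G (pull e Z) (pull e H) i b =
  \sum_x \sum_y e x i * e y b *
    \sum_(h : 3.-tuple 'I_8) Z [tuple of x :: h] * H [tuple of y :: h].
Proof.
pose P n (M : 'M[R]_8) (s t : n.-tuple 'I_8) := \prod_q M (tnth s q) (tnth t q).
transitivity (\sum_(t : 3.-tuple 'I_8) \sum_(u : 3.-tuple 'I_8)
   \sum_x \sum_(h : 3.-tuple 'I_8) \sum_y \sum_(k : 3.-tuple 'I_8)
     P _ G t u * (e x i * P _ e h t * Z [tuple of x :: h]) *
       (e y b * P _ e k u * H [tuple of y :: k])).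
  apply: eq_bigr => t _; apply: eq_bigr => u _; rewrite !pull_cons.
  rewrite [X in X * _]big_distrr /= big_distrl; apply: eq_bigr => x _ /=.
  rewrite [X in X * _]big_distrr /= big_distrl; apply: eq_bigr => h _ /=.
  rewrite big_distrr; apply: eq_bigr => y _ /=.
  by rewrite big_distrr.
under eq_bigr => t _ do rewrite exchange_big /=.
rewrite exchange_big; apply: eq_bigr => x _ /=.
transitivity (\sum_(h : 3.-tuple 'I_8) \sum_y \sum_(k : 3.-tuple 'I_8)
   \sum_(t : 3.-tuple 'I_8) \sum_(u : 3.-tuple 'I_8)
     P _ G t u * (e x i * P _ e h t * Z [tuple of x :: h]) *
       (e y b * P _ e k u * H [tuple of y :: k])).
  under eq_bigr => t _ do rewrite exchange_big /=.
  rewrite exchange_big; apply: eq_bigr => h _ /=.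
  under eq_bigr => t _ do rewrite exchange_big /=.
  rewrite exchange_big; apply: eq_bigr => y _ /=.
  under eq_bigr => t _ do rewrite exchange_big /=.
  by rewrite exchange_big.
rewrite exchange_big; apply: eq_bigr => y _ /=.
rewrite big_distrr; apply: eq_bigr => h _ /=.
transitivity (\sum_(k : 3.-tuple 'I_8) (k == h)%:R *
  (e x i * e y b * (Z [tuple of x :: h] * H [tuple of y :: k]))); last exact: sum_delta.
apply: eq_bigr => k _.
have -> : (k == h)%:R = \sum_(t : 3.-tuple 'I_8) \sum_(u : 3.-tuple 'I_8)
    P _ e h t * (P _ G t u * P _ e^T u k).
  rewrite eq_sym -(prod_mx1 R); have -> : 1%:M = e *m (G *m e^T).
    by rewrite (inv_gram_tr eU) mulmxV.
  rewrite -sum_prod_mx; apply: eq_bigr => t _.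
  by rewrite -sum_prod_mx big_distrr.
rewrite !big_distrl; apply: eq_bigr => t _ /=; rewrite !big_distrl; apply: eq_bigr => u _ /=.
have -> : P _ e^T u k = P _ e k u by apply: eq_bigr => q _; rewrite mxE.
have AC (a1 a2 a3 a4 a5 a6 a7 : R) : a1 * (a2 * a3 * a4) * (a5 * a6 * a7) =
  a3 * (a1 * a6) * (a2 * a5 * (a4 * a7)) by ring.
exact: AC.
Qed.

(** This is [frame_contract] for W = f^T B f, the matrix of B in the adapted frame. *)
Lemma contract_der (B : 'M[R]_8) i b : B^T = - B ->
  ctr3 G (der (B *m G) phi) phi i b =
  24 * B i b - 12 * \sum_p \sum_q (G *m B *m G) p q * phi [tuple p; q; i; b].
Proof.
move=> Bskew; pose W := f^T *m B *m f.
have BW : B = e^T *m W *m e.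
  by rewrite /W !mulmxA -trmx_mul mulVmx // trmx1 mul1mx -mulmxA mulVmx // mulmx1.
have Wskew : W^T = - W by rewrite /W !trmx_mul trmxK Bskew mulNmx mulmxN mulmxA.
have GBG : G *m B *m G = f *m W *m f^T by rewrite /G (inv_gram eU) /W /f !mulmxA.
clearbody W.
transitivity (ctr3 G (pull e (der W (stdr R))) (pull e (stdr R)) i b).
  apply: eq_bigr => t _; apply: eq_bigr => u _; congr (_ * _ * _) => //.
  rewrite (eq_der _ phiE) (der_pull (C := W)) //.
  rewrite -mulmxA (inv_gram_tr eU) {1}BW -[LHS]mulmxA mulmxV // mulmx1 //.
rewrite ctr3_pull.
have T (x y : 'I_8) : \sum_(h : 3.-tuple 'I_8) der W (stdr R) [tuple of x :: h] * stdr R [tuple of y :: h]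
   = 24 * W x y - 12 * \sum_j \sum_p W j p * stdr R [tuple j; p; x; y].
  rewrite -(frame_contract x y Wskew) sum_tupleS; apply: eq_bigr => j _.
  rewrite sum_tupleS; apply: eq_bigr => k _; rewrite sum_tupleS; apply: eq_bigr => l _.
  by rewrite sum_tuple0; congr (der _ _ _ * stdr _ _); apply: val_inj.
under eq_bigr => x _ do under eq_bigr => y _ do rewrite T mulrBr [_ * (24 * _)]mulrCA [_ * (12 * _)]mulrCA.
under eq_bigr => x _ do rewrite sumrB -!mulr_sumr.
rewrite sumrB -!mulr_sumr; congr (24 * _ - 12 * _).
  rewrite [in RHS]BW mxE exchange_big; apply: eq_bigr => y _ /=; rewrite mxE big_distrl.
  by apply: eq_bigr => x _ /=; rewrite mxE; ring.
rewrite GBG.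
have phiE4 p q : phi [tuple p; q; i; b] = \sum_j \sum_k \sum_x \sum_y
    e j p * e k q * (e x i * e y b * stdr R [tuple j; k; x; y]).
  have T4 (a1 a2 a3 a4 : 'I_8) (h : 0.-tuple 'I_8) : stdr R [tuple of a1 :: [tuple of a2 ::
      [tuple of a3 :: [tuple of a4 :: h]]]] = stdr R [tuple a1; a2; a3; a4].
    by congr stdr; apply: val_inj; rewrite /= tuple0.
  rewrite phiE pull_cons; apply: eq_bigr => j _.
  rewrite (sum_tupleS (n := 2)); apply: eq_bigr => k _.
  rewrite (sum_tupleS (n := 1)); apply: eq_bigr => x _.
  rewrite (sum_tupleS (n := 0)); apply: eq_bigr => y _.
  rewrite sum_tuple0 !big_ord_recl big_ord0 mulr1 T4.
  have AC (z t u v w : R) : z * (t * (u * v)) * w = z * t * (u * v * w) by ring.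
  exact: AC.
pose N := f *m W *m f^T.
have WN : W = e *m N *m e^T.
  by rewrite /N !mulmxA mulmxV // mul1mx -!mulmxA -trmx_mul mulmxV // trmx1 mulmx1.
transitivity (\sum_j \sum_k \sum_x \sum_y W j k * (e x i * e y b * stdr R [tuple j; k; x; y])).
  under eq_bigr => x _.
    under eq_bigr => y _ do rewrite big_distrr /=.
    rewrite exchange_big; over.
  rewrite exchange_big; apply: eq_bigr => j _ /=.
  under eq_bigr => x _.
    under eq_bigr => y _ do rewrite big_distrr /=.
    rewrite exchange_big; over.
  rewrite exchange_big; apply: eq_bigr => k _ /=.
  by apply: eq_bigr => x _; apply: eq_bigr => y _; rewrite mulrCA.
rewrite -/N; under [RHS]eq_bigr => p _ do under eq_bigr => q _ do rewrite phiE4 big_distrr /=.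
under [RHS]eq_bigr => p _ do rewrite exchange_big /=.
rewrite [RHS]exchange_big; apply: eq_bigr => j _ /=.
under [RHS]eq_bigr => p _ do under eq_bigr => q _ do rewrite big_distrr /=.
under [RHS]eq_bigr => p _ do rewrite exchange_big /=.
rewrite [RHS]exchange_big; apply: eq_bigr => k _ /=.
have -> : \sum_x \sum_y W j k * (e x i * e y b * stdr R [tuple j; k; x; y]) =
   W j k * \sum_x \sum_y (e x i * e y b * stdr R [tuple j; k; x; y]).
  by rewrite big_distrr; apply: eq_bigr => x _; rewrite big_distrr.
rewrite [in LHS]WN mxE big_distrl [RHS]exchange_big; apply: eq_bigr => q _ /=.
rewrite !mxE big_distrl big_distrl; apply: eq_bigr => p _ /=.
rewrite !big_distrr; apply: eq_bigr => x _ /=.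
rewrite !big_distrr; apply: eq_bigr => y _ /=.
have AC (z t u w : R) : z * t * u * w = t * (z * u * w) by ring.
exact: AC.
Qed.
End Coordinates.

(** * The metric as a function of the form *)

Section MetricFormula.
Variables (R : realType) (e : 'M[R]_8) (phi : tensor R 4).
Hypothesis phiE : forall s, phi s = pull e (stdr R) s.
Let g := e^T *m e.

Definition permL (w : 'S_8) : 4.-tuple 'I_8 := [tuple w (@lshift 4 4 i) | i < 4].
Definition permR (w : 'S_8) : 4.-tuple 'I_8 := [tuple w (@rshift 4 4 i) | i < 4].

(* The Levi-Civita symbol with upper indices is a density, whence [det e]. *)
Lemma star_pairing (F : tensor R 4) :
  \sum_(w : 'S_8) (-1) ^+ w * (phi (permL w) * pull e F (permR w)) =
  24 * \det e * \sum_s stdr R s * F s.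
Proof.
transitivity (\sum_(a : 4.-tuple 'I_8) \sum_(b : 4.-tuple 'I_8) \sum_(w : 'S_8)
   (-1) ^+ w * (\prod_q e (tnth [tuple of a ++ b] q) (w q)) * (stdr R a * F b)).
  transitivity (\sum_(w : 'S_8) \sum_(a : 4.-tuple 'I_8) \sum_(b : 4.-tuple 'I_8)
   (-1) ^+ w * (\prod_q e (tnth [tuple of a ++ b] q) (w q)) * (stdr R a * F b)).
    apply: eq_bigr => w _; rewrite phiE /pull big_distrl big_distrr; apply: eq_bigr => a _ /=.
    rewrite !big_distrr; apply: eq_bigr => b _ /=.
    rewrite (@big_split_ord _ _ _ 4 4) /=.
    rewrite [X in _ = _ * (X * _) * _](eq_bigr (fun q => e (tnth a q) (tnth (permL w) q))); last first.
      by move=> q _; rewrite tnth_lshift tnth_mktuple.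
    rewrite [X in _ = _ * (_ * X) * _](eq_bigr (fun q => e (tnth b q) (tnth (permR w) q))); last first.
      by move=> q _; rewrite tnth_rshift tnth_mktuple.
    have AC (a1 a2 a3 a4 a5 : R) : a1 * (a2 * a3 * (a4 * a5)) = a1 * (a2 * a4) * (a3 * a5) by ring.
    exact: AC.
  rewrite exchange_big; apply: eq_bigr => a _ /=; by rewrite exchange_big.
rewrite exchange_big big_distrr; apply: eq_bigr => b _ /=.
transitivity (\sum_(a : 4.-tuple 'I_8) stdr R a * levi R [tuple of a ++ b] * (\det e * F b)).
  apply: eq_bigr => a _; rewrite -big_distrl /=.
  have -> : \sum_(w : 'S_8) (-1) ^+ w * \prod_q e (tnth [tuple of a ++ b] q) (w q) =
            levi R [tuple of a ++ b] * \det e.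
    rewrite -det_rows; apply: eq_bigr => w _; congr (_ * _).
    by apply: eq_bigr => q _; rewrite mxE.
  have AC (a1 a2 a3 a4 : R) : a1 * a2 * (a3 * a4) = a3 * a1 * (a2 * a4) by ring.
  exact: AC.
rewrite -big_distrl /= std_selfdual.
have AC (a1 a2 a3 : R) : 24 * a1 * (a2 * a3) = 24 * a2 * (a1 * a3) by ring.
exact: AC.
Qed.

(** 336 = 8 * 42, the trace of [std_norm]; equivalently, 14 monomials in 4! orders each. *)
Lemma std_square : \sum_s stdr R s * stdr R s = 336.
Proof.
transitivity (\sum_(i < 8) (42 : R)); last by rewrite sumr_const card_ord -mulr_natr; ring.
rewrite sum_tupleS; apply: eq_bigr => i _.
have := std_norm R i i; rewrite eqxx mulr1 => <-.
rewrite sum_tupleS; apply: eq_bigr => j _.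
rewrite sum_tupleS; apply: eq_bigr => k _; rewrite sum_tupleS; apply: eq_bigr => l _.
by rewrite sum_tuple0; congr (stdr _ _ * stdr _ _); apply: val_inj.
Qed.

(** Two uses of [std_contract]: the Kronecker terms of the first give 12 phi, and its term -4 phi
    leads to a second contraction that gives 16 phi and the minor with factor -24. *)
Lemma std_cube (i j k l : 'I_8) :
  \sum_a \sum_b \sum_c \sum_d stdr R [tuple a; b; c; d] *
     (stdr R [tuple a; b; i; j] * stdr R [tuple c; d; k; l]) =
  28 * stdr R [tuple i; j; k; l] -
  24 * ((i == k)%:R * (j == l)%:R - (i == l)%:R * (j == k)%:R).
Proof.
have swap a b c d : stdr R [tuple a; b; c; d] = stdr R [tuple c; d; a; b].
  rewrite std_swap23 std_swap12 opprK std_swap34 std_swap23 opprK //.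
transitivity (\sum_c \sum_d (\sum_a \sum_b stdr R [tuple c; d; a; b] * stdr R [tuple i; j; a; b]) *
   stdr R [tuple c; d; k; l]).
  under eq_bigr => a _ do rewrite exchange_big /=.
  rewrite exchange_big; apply: eq_bigr => c _ /=.
  under eq_bigr => a _ do rewrite exchange_big /=.
  rewrite exchange_big; apply: eq_bigr => d _ /=.
  rewrite big_distrl; apply: eq_bigr => a _ /=; rewrite big_distrl; apply: eq_bigr => b _ /=.
  by rewrite mulrA swap (swap i j).
transitivity (\sum_c \sum_d ((c == i)%:R * (6 * ((d == j)%:R * stdr R [tuple c; d; k; l]))
  - (c == j)%:R * (6 * ((d == i)%:R * stdr R [tuple c; d; k; l]))
  - 4 * (stdr R [tuple i; j; c; d] * stdr R [tuple k; l; c; d]))).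
  apply: eq_bigr => c _; apply: eq_bigr => d _; rewrite std_contract.
  rewrite (swap i j c d) (swap k l c d).
  have AC (a1 a2 a3 a4 a5 a6 : R) : (6 * a1 * a2 - 6 * a3 * a4 - 4 * a5) * a6 =
    a1 * (6 * (a2 * a6)) - a3 * (6 * (a4 * a6)) - 4 * (a5 * a6) by ring.
  exact: AC.
under eq_bigr => c _ do rewrite !sumrB -!mulr_sumr !sum_delta.
rewrite !sumrB !sum_delta -mulr_sumr std_contract (std_swap12 R i j k l).
move: (stdr R _) (i == k)%:R (j == l)%:R (i == l)%:R (j == k)%:R => x y z t u.
ring.
Qed.

Lemma star_square : \sum_(w : 'S_8) (-1) ^+ w * (phi (permL w) * phi (permR w)) =
  24 * 336 * \det e.
Proof.
under eq_bigr => w _ do rewrite [phi (permR w)]phiE.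
by rewrite star_pairing std_square mulrAC.
Qed.

Lemma pull4 (F : tensor R 4) i j k l : pull e F [tuple i; j; k; l] =
  \sum_a \sum_b \sum_c \sum_d e a i * e b j * e c k * e d l * F [tuple a; b; c; d].
Proof.
rewrite /pull sum_tupleS; apply: eq_bigr => a _; rewrite sum_tupleS; apply: eq_bigr => b _.
rewrite sum_tupleS; apply: eq_bigr => c _; rewrite sum_tupleS; apply: eq_bigr => d _.
rewrite sum_tuple0; congr (_ * _); first by rewrite !big_ord_recl big_ord0 mulr1 /= !mulrA.
Qed.

(** Only the four indices in [s] meet the Levi-Civita symbol; i, j, k, l stay free and become the
    indices of a minor of the metric. *)
Definition pairing (i j k l : 'I_8) (s : 4.-tuple 'I_8) : R :=
  phi [tuple nth ord0 s 0; nth ord0 s 1; i; j] * phi [tuple nth ord0 s 2; nth ord0 s 3; k; l].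

Lemma pairingE i j k l s : pairing i j k l s = pull e (fun s =>
  \sum_x \sum_y \sum_z \sum_t (e x i * e y j * e z k * e t l) *
    (stdr R [tuple nth ord0 s 0; nth ord0 s 1; x; y] *
     stdr R [tuple nth ord0 s 2; nth ord0 s 3; z; t])) s.
Proof.
have [a [b [c [d ->]]]] := tuple4_eta s.
rewrite pull4 /pairing !phiE !pull4.
transitivity (\sum_p \sum_q \sum_x \sum_y \sum_r \sum_s \sum_z \sum_t
   e p a * e q b * e x i * e y j * stdr R [tuple p; q; x; y] *
   (e r c * e s d * e z k * e t l * stdr R [tuple r; s; z; t])).
  do 4 (rewrite big_distrl; apply: eq_bigr => ? _ /=).
  by do 4 (rewrite big_distrr; apply: eq_bigr => ? _ /=).
apply: eq_bigr => p _; apply: eq_bigr => q _.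
transitivity (\sum_r \sum_s \sum_x \sum_y \sum_z \sum_t
   e p a * e q b * e x i * e y j * stdr R [tuple p; q; x; y] *
   (e r c * e s d * e z k * e t l * stdr R [tuple r; s; z; t])).
  under eq_bigr => x _ do rewrite exchange_big /=.
  rewrite exchange_big; apply: eq_bigr => r _ /=.
  under eq_bigr => x _ do rewrite exchange_big /=.
  by rewrite exchange_big.
apply: eq_bigr => r _; apply: eq_bigr => s' _.
do 4 (rewrite big_distrr; apply: eq_bigr => ? _ /=).
have AC (a1 a2 a3 a4 a5 a6 a7 a8 a9 b1 : R) : a1 * a2 * a3 * a4 * a5 * (a6 * a7 * a8 * a9 * b1) =
  a1 * a2 * a6 * a7 * (a3 * a4 * a8 * a9 * (a5 * b1)) by ring.
exact: AC.
Qed.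

(** Two copies of phi use up the eight upper indices of the Levi-Civita symbol and yield only det e.
    A third copy leaves four free indices, enough for products of two metric entries; after
    [star_pairing] the frame computation is [std_cube]. *)
Lemma star_cube (i j k l : 'I_8) :
  \sum_(w : 'S_8) (-1) ^+ w * (phi (permL w) * pairing i j k l (permR w)) =
  24 * \det e * (28 * phi [tuple i; j; k; l] - 24 * (g i k * g j l - g i l * g j k)).
Proof.
under eq_bigr => w _ do rewrite pairingE.
rewrite star_pairing; congr (_ * _).
transitivity (\sum_x \sum_y \sum_z \sum_t (e x i * e y j * e z k * e t l) *
  \sum_a \sum_b \sum_c \sum_d stdr R [tuple a; b; c; d] *
     (stdr R [tuple a; b; x; y] * stdr R [tuple c; d; z; t])).
  under eq_bigr => s _ do rewrite big_distrr /=.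
  rewrite exchange_big; apply: eq_bigr => x _ /=.
  under eq_bigr => s _ do rewrite big_distrr /=.
  rewrite exchange_big; apply: eq_bigr => y _ /=.
  under eq_bigr => s _ do rewrite big_distrr /=.
  rewrite exchange_big; apply: eq_bigr => z _ /=.
  under eq_bigr => s _ do rewrite big_distrr /=.
  rewrite exchange_big; apply: eq_bigr => t _ /=.
  rewrite big_distrr sum_tupleS; apply: eq_bigr => a _ /=.
  rewrite big_distrr sum_tupleS; apply: eq_bigr => b _ /=.
  rewrite big_distrr sum_tupleS; apply: eq_bigr => c _ /=.
  rewrite big_distrr sum_tupleS; apply: eq_bigr => d _ /=.
  rewrite sum_tuple0 mulrCA; congr (_ * (stdr _ _ * _)); exact: val_inj.
under eq_bigr => x _ do under eq_bigr => y _ do under eq_bigr => z _ do under eq_bigr => t _ do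
  rewrite std_cube mulrBr mulrCA [_ * (24 * _)]mulrCA mulrBr.
under eq_bigr => x _ do under eq_bigr => y _ do under eq_bigr => z _ do rewrite sumrB -!mulr_sumr sumrB.
under eq_bigr => x _ do under eq_bigr => y _ do rewrite sumrB -!mulr_sumr sumrB.
under eq_bigr => x _ do rewrite sumrB -!mulr_sumr sumrB.
rewrite sumrB -!mulr_sumr sumrB phiE pull4.
have gE p q : g p q = \sum_x e x p * e x q.
  by rewrite mxE; apply: eq_bigr => x _; rewrite mxE.
congr (_ - _ * (_ - _)).
  rewrite !gE big_distrl; apply: eq_bigr => x _ /=; rewrite big_distrr; apply: eq_bigr => y _ /=.
  transitivity (\sum_z (z == x)%:R * \sum_t (t == y)%:R * (e x i * e y j * e z k * e t l)).
    apply: eq_bigr => z _; rewrite big_distrr; apply: eq_bigr => t _ /=.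
    by rewrite mulrA [RHS]mulrC (eq_sym z) (eq_sym t).
  by rewrite !sum_delta -!mulrA; congr (_ * _); rewrite mulrCA.
rewrite !gE big_distrl; apply: eq_bigr => x _ /=; rewrite big_distrr; apply: eq_bigr => y _ /=.
transitivity (\sum_z (z == y)%:R * \sum_t (t == x)%:R * (e x i * e y j * e z k * e t l)).
  apply: eq_bigr => z _; rewrite big_distrr; apply: eq_bigr => t _ /=.
  by rewrite mulrA [RHS]mulrC (eq_sym z) (eq_sym t) [in RHS](mulrC (_ == _)%:R).
by rewrite !sum_delta -!mulrA; congr (_ * _); rewrite mulrA mulrC.
Qed.
End MetricFormula.

(** * Expressions in the components of the form *)

Section Orbit.
Variable R : realType.

Definition spin7_orbit : set (tensor R 4) := [set phi | exists e, adapted phi e].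

Lemma adapted_coframeP phi : spin7_orbit phi ->
  adapted_coframe phi \in unitmx /\ forall s, phi s = pull (adapted_coframe phi) (stdr R) s.
Proof.
move=> /(@xgetPex _ 1%:M [set e | adapted phi e]) [eU phiE]; split=> // s.
by rewrite {1}phiE spin7_formE.
Qed.

(* [adapted_coframe] is an arbitrary choice, so the smoothness of the metric has
   to come from an expression in the components of the form alone. *)
Inductive elementary : (tensor R 4 -> R) -> Prop :=
| elementary_coord s : elementary (fun phi => phi s)
| elementary_cst c : elementary (fun=> c)
| elementary_add f g : elementary f -> elementary g -> elementary (fun phi => f phi + g phi)
| elementary_mul f g : elementary f -> elementary g -> elementary (fun phi => f phi * g phi)
| elementary_inv f : elementary f -> (forall phi, spin7_orbit phi -> f phi != 0) ->
    elementary (fun phi => (f phi)^-1)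
| elementary_sqrt f : elementary f -> (forall phi, spin7_orbit phi -> 0 < f phi) ->
    elementary (fun phi => Num.sqrt (f phi))
| elementary_eq f g : elementary f -> (forall phi, spin7_orbit phi -> f phi = g phi) ->
    elementary g.

Lemma elementary_sum (I : Type) (r : seq I) (P : pred I) (F : I -> tensor R 4 -> R) :
  (forall i, elementary (F i)) -> elementary (fun phi => \sum_(i <- r | P i) F i phi).
Proof.
move=> FE; elim: r => [|i r IH].
  by apply: (elementary_eq (elementary_cst 0)) => phi _; rewrite big_nil.
have [Pi|Pi] := boolP (P i).
  by apply: (elementary_eq (elementary_add (FE i) IH)) => phi _; rewrite big_cons Pi.
by apply: (elementary_eq IH) => phi _; rewrite big_cons (negPf Pi).
Qed.

Lemma elementary_prod (I : Type) (r : seq I) (P : pred I) (F : I -> tensor R 4 -> R) :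
  (forall i, elementary (F i)) -> elementary (fun phi => \prod_(i <- r | P i) F i phi).
Proof.
move=> FE; elim: r => [|i r IH].
  by apply: (elementary_eq (elementary_cst 1)) => phi _; rewrite big_nil.
have [Pi|Pi] := boolP (P i).
  by apply: (elementary_eq (elementary_mul (FE i) IH)) => phi _; rewrite big_cons Pi.
by apply: (elementary_eq IH) => phi _; rewrite big_cons (negPf Pi).
Qed.

Lemma elementary_scale c f : elementary f -> elementary (fun phi => c * f phi).
Proof. by move=> fE; apply: elementary_mul => //; apply: elementary_cst. Qed.

Lemma elementary_sub f g : elementary f -> elementary g -> elementary (fun phi => f phi - g phi).
Proof.
move=> fE gE; apply: (elementary_eq (elementary_add fE (elementary_scale (-1) gE))) => phi _.
by rewrite mulN1r.
Qed.

Lemma elementary_det n (A : tensor R 4 -> 'M[R]_n) :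
  (forall i j, elementary (fun phi => A phi i j)) -> elementary (fun phi => \det (A phi)).
Proof.
by move=> AE; apply: elementary_sum => w; apply: elementary_scale; apply: elementary_prod.
Qed.

Definition star2 (phi : tensor R 4) : R :=
  \sum_(w : 'S_8) (-1) ^+ w * (phi (permL w) * phi (permR w)).
Definition star3 (i j k l : 'I_8) (phi : tensor R 4) : R :=
  \sum_(w : 'S_8) (-1) ^+ w * (phi (permL w) * pairing phi i j k l (permR w)).

(** This is [star_cube] solved for the minor, with det e eliminated by [star_square]; their common
    factor 24 cancels and 336 remains. *)
Definition minor2 (i j k l : 'I_8) (phi : tensor R 4) : R :=
  24^-1 * (28 * phi [tuple i; j; k; l] - 336 * (star3 i j k l phi / star2 phi)).

Definition gram3 (g : 'M[R]_8) (i j k : 'I_8) : R :=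
  g i i * (g j j * g k k - g j k ^+ 2) - g i j * (g i j * g k k - g j k * g i k)
  + g i k * (g i j * g j k - g j j * g i k).

(** Cofactors of the symmetric block of the metric on i, j, k: minors of order two, hence
    expressible through phi. *)
Definition cof11 (i j k : 'I_8) phi : R := minor2 j k j k phi.
Definition cof22 (i j k : 'I_8) phi : R := minor2 i k i k phi.
Definition cof33 (i j k : 'I_8) phi : R := minor2 i j i j phi.
Definition cof12 (i j k : 'I_8) phi : R := - 1 * minor2 i k j k phi.
Definition cof13 (i j k : 'I_8) phi : R := minor2 i j j k phi.
Definition cof23 (i j k : 'I_8) phi : R := - 1 * minor2 i j i k phi.

(** The determinant of the cofactor matrix. Blocks of size three are the smallest whose minors of
    order two recover the entries up to a common sign, and positivity of the metric fixes that
    sign. *)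
Definition sqr_gram3 (i j k : 'I_8) (phi : tensor R 4) : R :=
  let A11 := cof11 i j k phi in let A22 := cof22 i j k phi in let A33 := cof33 i j k phi in
  let A12 := cof12 i j k phi in let A13 := cof13 i j k phi in let A23 := cof23 i j k phi in
  A11 * (A22 * A33 - A23 * A23) - A12 * (A12 * A33 - A23 * A13) + A13 * (A12 * A23 - A22 * A13).

Section AtPoint.
Variables (phi : tensor R 4) (e : 'M[R]_8).
Hypothesis eU : e \in unitmx.
Hypothesis phiE : forall s, phi s = pull e (stdr R) s.
Let g := e^T *m e.

Lemma star2_neq0 : star2 phi != 0.
Proof.
rewrite /star2 (star_square phiE); apply: mulf_neq0; last by rewrite -unitfE -unitmxE.
by apply/lt0r_neq0; lra.
Qed.

Lemma minor2E i j k l : minor2 i j k l phi = g i k * g j l - g i l * g j k.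
Proof.
rewrite /minor2 /star3 (star_cube phiE) /star2 (star_square phiE) -/g.
have : \det e != 0 by rewrite -unitfE -unitmxE.
move: (\det _) (phi _) (g i k) (g j l) (g i l) (g j k) => d p a b c f d0.
by field.
Qed.

Lemma gram_sym i j : g i j = g j i.
Proof. by rewrite /g -[in LHS](trmxK e) -trmx_mul mxE trmxK. Qed.

Lemma gram_posdef (v : 'cV[R]_8) : v != 0 -> 0 < (v^T *m g *m v) 0 0.
Proof.
move=> v0; have -> : v^T *m g *m v = (e *m v)^T *m (e *m v).
  by rewrite trmx_mul !mulmxA.
have : e *m v != 0.
  by apply: contraNneq v0 => /(congr1 (mulmx (invmx e))); rewrite mulKmx // mulmx0 => ->.
move: (e *m v) => w w0; rewrite mxE lt_neqAle eq_sym; apply/andP; split; last first.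
  by apply: sumr_ge0 => i _; rewrite mxE -expr2 sqr_ge0.
apply: contraNneq w0 => /eqP; rewrite psumr_eq0; last first.
  by move=> i _; rewrite mxE -expr2 sqr_ge0.
move=> /allP w0; apply/eqP/matrixP => i j; rewrite (ord1 j) [RHS]mxE.
have := w0 i (mem_index_enum i); rewrite mxE mulf_eq0 orbb => /eqP //.
Qed.

Lemma gram3_pos (i j k : 'I_8) (x y z : R) : uniq [:: i; j; k] ->
  (x != 0) || (y != 0) || (z != 0) ->
  0 < x ^+ 2 * g i i + y ^+ 2 * g j j + z ^+ 2 * g k k +
      2 * (x * y * g i j + x * z * g i k + y * z * g j k).
Proof.
rewrite /= !inE negb_or andbT => /andP[/andP[ij ik] jk] xyz.
pose v : 'cV[R]_8 := x *: delta_mx i 0 + y *: delta_mx j 0 + z *: delta_mx k 0.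
have gE p q : (delta_mx p 0 : 'cV[R]_8)^T *m g *m delta_mx q 0 = (g p q)%:M.
  rewrite trmx_delta -rowE -colE; apply/matrixP => a b.
  by rewrite !mxE !ord1 eqxx.
have v0 : v != 0.
  apply: contraTneq xyz => /matrixP v0; rewrite !negb_or !negbK.
  have := v0 i 0; have := v0 j 0; have := v0 k 0.
  rewrite !mxE !eqxx /= (eq_sym j i) (eq_sym k i) (eq_sym k j) (negPf ij) (negPf ik) (negPf jk).
  by rewrite !mulr0 !mulr1 !addr0 !add0r => -> -> ->; rewrite !eqxx.
have := gram_posdef v0; congr (0 < _).
rewrite /v !(linearD, linearZ) /= !mulmxDl -!scalemxAl.
rewrite !gE (gram_sym j i) (gram_sym k i) (gram_sym k j).
move: (g i i) (g j j) (g k k) (g i j) (g i k) (g j k) => a b c h p q.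
by rewrite !mxE !mulr1n; ring.
Qed.

Lemma gram3_gt0 i j k : uniq [:: i; j; k] -> 0 < gram3 g i j k.
Proof.
move=> /gram3_pos Q; rewrite /gram3.
move: (g i i) (g j j) (g k k) (g i j) (g i k) (g j k) Q => a b c h p q Q.
(* The test vectors are the last columns of the adjugates of the leading blocks; on them the
   quadratic form is the product of two consecutive leading minors. *)
have a0 : 0 < a by have := Q 1 0 0; rewrite oner_eq0 => /(_ isT); lra.
have m0 : 0 < a * b - h ^+ 2.
  rewrite -(pmulr_rgt0 _ a0).
  by have := Q (- h) a 0; rewrite (gt_eqF a0) ?orbT => /(_ isT); lra.
rewrite -(pmulr_rgt0 _ m0).
have := Q (h * q - p * b) (h * p - a * q) (a * b - h ^+ 2).
by rewrite (gt_eqF m0) !orbT => /(_ isT); lra.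
Qed.

Lemma sqr_gram3E i j k : sqr_gram3 i j k phi = gram3 g i j k ^+ 2.
Proof.
rewrite /sqr_gram3 /cof11 /cof22 /cof33 /cof12 /cof13 /cof23 /gram3 !minor2E.
rewrite ?(gram_sym j i) ?(gram_sym k i) ?(gram_sym k j).
move: (g i i) (g j j) (g k k) (g i j) (g i k) (g j k) => a b c h p q; ring.
Qed.

Lemma sqrt_sqr_gram3 i j k : uniq [:: i; j; k] ->
  Num.sqrt (sqr_gram3 i j k phi) = gram3 g i j k.
Proof. by move=> ijk; rewrite sqr_gram3E sqrtr_sqr gtr0_norm // gram3_gt0. Qed.

(* For a symmetric matrix S of size 3 with cofactor matrix C, one has
   det C = (det S)^2 and cof C = (det S) S. *)
Lemma gram_diagE i j k : uniq [:: i; j; k] ->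
  g i i = (cof22 i j k phi * cof33 i j k phi - cof23 i j k phi * cof23 i j k phi) *
          (Num.sqrt (sqr_gram3 i j k phi))^-1.
Proof.
move=> ijk; rewrite sqrt_sqr_gram3 //; have := gram3_gt0 ijk.
rewrite /cof22 /cof33 /cof23 !minor2E /gram3.
rewrite ?(gram_sym j i) ?(gram_sym k i) ?(gram_sym k j).
move: (g i i) (g j j) (g k k) (g i j) (g i k) (g j k) => a b c h p q d0.
by apply: (mulIf (lt0r_neq0 d0)); rewrite -[RHS]mulrA mulVf ?lt0r_neq0 //; ring.
Qed.

Lemma gram_offE i j k : uniq [:: i; j; k] ->
  g i j = (cof23 i j k phi * cof13 i j k phi - cof12 i j k phi * cof33 i j k phi) *
          (Num.sqrt (sqr_gram3 i j k phi))^-1.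
Proof.
move=> ijk; rewrite sqrt_sqr_gram3 //; have := gram3_gt0 ijk.
rewrite /cof12 /cof33 /cof23 /cof13 !minor2E /gram3.
rewrite ?(gram_sym j i) ?(gram_sym k i) ?(gram_sym k j).
move: (g i i) (g j j) (g k k) (g i j) (g i k) (g j k) => a b c h p q d0.
by apply: (mulIf (lt0r_neq0 d0)); rewrite -[RHS]mulrA mulVf ?lt0r_neq0 //; ring.
Qed.
End AtPoint.

Lemma elementary_minor2 i j k l : elementary (minor2 i j k l).
Proof.
apply: elementary_scale; apply: elementary_sub; first exact/elementary_scale/elementary_coord.
apply: elementary_scale; apply: elementary_mul.
  apply: elementary_sum => w; apply: elementary_scale; apply: elementary_mul.
    exact: elementary_coord.
  by apply: elementary_mul; apply: elementary_coord.
apply: elementary_inv; last by move=> phi /adapted_coframeP[eU phiE]; apply: star2_neq0 eU phiE.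
apply: elementary_sum => w; apply: elementary_scale.
by apply: elementary_mul; apply: elementary_coord.
Qed.

Lemma elementary_cof_diag i j k :
  [/\ elementary (cof11 i j k), elementary (cof22 i j k) & elementary (cof33 i j k)].
Proof. by split; apply: elementary_minor2. Qed.

Lemma elementary_cof_off i j k :
  [/\ elementary (cof12 i j k), elementary (cof13 i j k) & elementary (cof23 i j k)].
Proof.
by split; [apply: elementary_scale | | apply: elementary_scale]; apply: elementary_minor2.
Qed.

Lemma elementary_gram3_inv i j k : uniq [:: i; j; k] ->
  elementary (fun phi => (Num.sqrt (sqr_gram3 i j k phi))^-1).
Proof.
move=> ijk; apply: elementary_inv; last first.
  move=> phi /adapted_coframeP[eU phiE].
  by rewrite (sqrt_sqr_gram3 eU phiE) // gt_eqF // (gram3_gt0 eU ijk).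
apply: elementary_sqrt; last first.
  move=> phi /adapted_coframeP[eU phiE].
  by rewrite (sqr_gram3E eU phiE) exprn_gt0 // (gram3_gt0 eU ijk).
have [C11 C22 C33] := elementary_cof_diag i j k.
have [C12 C13 C23] := elementary_cof_off i j k.
rewrite /sqr_gram3 /=.
by apply: elementary_add; [apply: elementary_sub|]; apply: elementary_mul => //;
  apply: elementary_sub; apply: elementary_mul => //.
Qed.

Lemma exists_notin (s : seq 'I_8) : (size s < 8)%N -> exists k, k \notin s.
Proof.
move=> s8; apply/existsP; rewrite -negb_forall; apply: contraL s8 => /forallP sI.
rewrite -leqNgt -[X in (X <= _)%N](size_enum_ord 8); apply: uniq_leq_size (enum_uniq _) _ => k _.
exact: sI.
Qed.

(* The metric is a polynomial in [phi], the inverse of [star2 phi] and the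
   inverse of a square root; in particular it does not depend on the coframe. *)
Lemma elementary_gram i j : exists F, elementary F /\
  forall phi e, e \in unitmx -> (forall s, phi s = pull e (stdr R) s) -> (e^T *m e) i j = F phi.
Proof.
have [<-{j}|ij] := eqVneq i j.
  have [j ij] := @exists_notin [:: i] isT; have [k ijk] := @exists_notin [:: j; i] isT.
  have {}ijk : uniq [:: i; j; k].
    by move: ij ijk; rewrite /= !inE !negb_or !(eq_sym i) (eq_sym j k) => -> /andP[-> ->].
  exists (fun phi => (cof22 i j k phi * cof33 i j k phi -
     cof23 i j k phi * cof23 i j k phi) * (Num.sqrt (sqr_gram3 i j k phi))^-1); split.
    apply: elementary_mul; last exact: elementary_gram3_inv.
    have [C11 C22 C33] := elementary_cof_diag i j k.
    have [C12 C13 C23] := elementary_cof_off i j k.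
    by apply: elementary_sub; apply: elementary_mul.
  by move=> phi e eU phiE; apply: gram_diagE.
have [k ijk] := @exists_notin [:: j; i] isT.
have {}ijk : uniq [:: i; j; k].
  by move: ij ijk; rewrite /= !inE !negb_or (eq_sym i k) (eq_sym j k) => -> /andP[-> ->].
exists (fun phi => (cof23 i j k phi * cof13 i j k phi -
     cof12 i j k phi * cof33 i j k phi) * (Num.sqrt (sqr_gram3 i j k phi))^-1); split.
  apply: elementary_mul; last exact: elementary_gram3_inv.
  have [C11 C22 C33] := elementary_cof_diag i j k.
  have [C12 C13 C23] := elementary_cof_off i j k.
  by apply: elementary_sub; apply: elementary_mul.
by move=> phi e eU phiE; apply: gram_offE.
Qed.

Lemma elementary_metric i j : elementary (fun phi => metric phi i j).
Proof.
have [F [FE gF]] := elementary_gram i j; apply: elementary_eq FE _ => phi.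
by move=> /adapted_coframeP[eU phiE]; rewrite -(gF _ _ eU phiE).
Qed.

(** Any two coframes adapted to phi give the same value of the expression from [elementary_gram], so
    independence of the choice follows without computing the stabilizer. *)
Lemma metric_adapted (phi : tensor R 4) e : adapted phi e -> metric phi = e^T *m e.
Proof.
move=> phie; have phiO : spin7_orbit phi by exists e.
have [eU phiE] := adapted_coframeP phiO; apply/matrixP => i j.
have [F [_ gF]] := elementary_gram i j; rewrite /metric (gF _ _ eU phiE) (gF phi) //.
  by case: phie.
by move=> s; rewrite {1}(proj2 phie) spin7_formE.
Qed.

Lemma metric_unit phi : spin7_orbit phi -> metric phi \in unitmx.
Proof.
move=> /adapted_coframeP[eU _].
by rewrite /metric unitmx_mul unitmx_tr eU.
Qed.

Lemma elementary_metric_inv i j : elementary (fun phi => metric_inv phi i j).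
Proof.
apply: (elementary_eq (f := fun phi => (\det (metric phi))^-1 * cofactor (metric phi) j i)).
  apply: elementary_mul; first apply: elementary_inv.
  - exact: elementary_det elementary_metric.
  - by move=> phi /metric_unit; rewrite unitmxE unitfE.
  apply: elementary_scale; apply: elementary_det => a b.
  apply: (elementary_eq (elementary_metric (lift j a) (lift i b))) => phi _.
  by rewrite !mxE.
by move=> phi phiO; rewrite /metric_inv /invmx metric_unit // !mxE.
Qed.
End Orbit.

(** * Smooth functions and mixed partial derivatives *)

Section Calculus.
Variables (R : realType) (V : normedModType R).
Implicit Types (f g : V -> R) (x v : V) (U : set V).

Lemma is_deriveDf f g x v a b : is_derive x v f a -> is_derive x v g b ->
  is_derive x v (fun y => f y + g y) (a + b).
Proof. exact: is_deriveD. Qed.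

Lemma is_deriveMf f g x v a b : is_derive x v f a -> is_derive x v g b ->
  is_derive x v (fun y => f y * g y) (a * g x + f x * b).
Proof.
move=> fa gb; have fgab : is_derive x v (fun y => f y * g y) (f x *: b + g x *: a).
  exact: is_deriveM fa gb.
by apply: is_derive_eq fgab _; rewrite addrC; congr (_ + _); apply: mulrC.
Qed.

Lemma is_deriveZf c f x v a : is_derive x v f a -> is_derive x v (fun y => c * f y) (c * a).
Proof.
move=> fa; apply: is_derive_eq (is_deriveMf (is_derive_cst c x v) fa) _.
by rewrite mul0r add0r.
Qed.

Lemma is_deriveBf f g x v a b : is_derive x v f a -> is_derive x v g b ->
  is_derive x v (fun y => f y - g y) (a - b).
Proof. exact: is_deriveB. Qed.

Lemma is_derive_sumf (I : finType) (F : I -> V -> R) (a : I -> R) x v :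
  (forall i, is_derive x v (F i) (a i)) ->
  is_derive x v (fun y => \sum_i F i y) (\sum_i a i).
Proof.
move=> FE; rewrite (_ : (fun y => _) = \sum_i F i); last first.
  by apply/funext => y; rewrite fct_sumE.
by elim/big_ind2 : _ => // [|] *; [exact: is_derive_cst|exact: is_deriveD].
Qed.

Lemma is_deriveVf f x v a : f x != 0 -> is_derive x v f a ->
  is_derive x v (fun y => (f y)^-1) (- (f x) ^- 2 * a).
Proof.
move=> f0 [fd <-]; constructor; first exact: derivableV.
by rewrite deriveV.
Qed.

Lemma is_derive_line f x v d :
  is_derive x v f d <-> is_derive (0 : R) 1 (fun h : R => f (h *: v + x)) d.
Proof.
have E : 'D_v f x = 'D_1 (fun h : R => f (h *: v + x)) 0.
  rewrite /derive; set g1 := fun h => h^-1 *: _; set g2 := fun h => h^-1 *: _.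
  suff -> : g1 = g2 by [].
  by rewrite funeqE /g1 /g2 => h /=; rewrite addr0 scale0r add0r [_%:A]mulr1.
split=> -[fd <-].
  by split; [move/derivable1P: fd | exact/esym].
by split; [apply/derivable1P | exact: E].
Qed.

Lemma is_derive_sqrtf f x v a : 0 < f x -> is_derive x v f a ->
  is_derive x v (fun y => Num.sqrt (f y)) ((2 * Num.sqrt (f x))^-1 * a).
Proof.
move=> f0 /is_derive_line fa; apply/is_derive_line.
apply: (is_derive1_comp (f := Num.sqrt) (g := fun h : R => f (h *: v + x))) => //.
by rewrite scale0r add0r; apply: is_derive1_sqrt.
Qed.

Lemma open_near_eq U f g x : open U -> U x -> (forall y, U y -> f y = g y) ->
  \near x, f x = g x.
Proof. by move=> oU Ux fg; near=> y; apply: fg; near: y; apply: open_nbhs_nbhs. Unshelve. all: by end_near. Qed.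

Lemma open_eq_continuous U f g x : open U -> U x -> (forall y, U y -> f y = g y) ->
  {for x, continuous f} -> {for x, continuous g}.
Proof.
move=> oU Ux fg fc; suff : g @ x --> g x by [].
rewrite -fg //; apply: cvg_trans fc; apply: near_eq_cvg; exact: open_near_eq Ux fg.
Qed.

Lemma Ck_on_eq k U f g : open U -> (forall y, U y -> f y = g y) -> Ck_on k U f -> Ck_on k U g.
Proof.
move=> oU; elim: k f g => [|k IH] f g fg [fc fd]; split=> //.
- by move=> x Ux; apply: open_eq_continuous oU Ux fg (fc x Ux).
- by move=> x Ux; apply: open_eq_continuous oU Ux fg (fc x Ux).
- move=> v; have [fdv fk] := fd v; split=> [x Ux|].
    by apply: near_eq_derivable (fdv x Ux); apply: open_near_eq Ux fg.
  by apply: IH fk => y Uy; apply: near_eq_derive; apply: open_near_eq Uy fg.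
Qed.

Lemma Ck_onW k U f : Ck_on k.+1 U f -> Ck_on k U f.
Proof.
elim: k f => [|k IH] f [fc fd]; split=> // v; have [fdv fk] := fd v; split=> //.
exact: IH.
Qed.

(** On an open set it is enough to exhibit a function that agrees there with the derivative; the
    closure properties below run their inductions on such explicit derivatives. *)
Lemma Ck_onS k U f (df : V -> V -> R) : open U -> (forall x, U x -> {for x, continuous f}) ->
  (forall v x, U x -> is_derive x v f (df v x)) ->
  (forall v, Ck_on k U (df v)) -> Ck_on k.+1 U f.
Proof.
move=> oU fc fd dk; split=> // v; split=> [x Ux|]; first by case: (fd v x Ux).
by apply: Ck_on_eq (dk v) => // y Uy; case: (fd v y Uy).
Qed.

Lemma Ck_on_cst k U c : open U -> Ck_on k U (fun=> c : R).
Proof.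
move=> oU; elim: k c => [|k IH] c; first by split=> // x _; exact: cvg_cst.
apply: (Ck_onS (df := fun _ _ => 0)) => //.
by move=> x _; apply: cvg_cst.
Qed.

Lemma Ck_on_cont k U f x : Ck_on k U f -> U x -> {for x, continuous f}.
Proof. by case: k => [|k] [fc _]; apply: fc. Qed.

Lemma Ck_on_derive k U f v x : Ck_on k.+1 U f -> U x -> is_derive x v f ('D_v f x).
Proof. by case=> _ /(_ v)[fd _] Ux; apply/derivableP/fd. Qed.

Lemma Ck_on_D k U f v : Ck_on k.+1 U f -> Ck_on k U (fun x => 'D_v f x).
Proof. by case=> _ /(_ v)[]. Qed.

Lemma Ck_on_add k U f g : open U -> Ck_on k U f -> Ck_on k U g -> Ck_on k U (fun x => f x + g x).
Proof.
move=> oU; elim: k f g => [|k IH] f g fk gk.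
  by split=> // x Ux; apply: cvgD; [apply: Ck_on_cont fk Ux | apply: Ck_on_cont gk Ux].
apply: (Ck_onS oU (df := fun v x => 'D_v f x + 'D_v g x)).
- by move=> x Ux; apply: cvgD; [apply: Ck_on_cont fk Ux | apply: Ck_on_cont gk Ux].
- by move=> v x Ux; apply: is_deriveDf; apply: Ck_on_derive Ux; eassumption.
- by move=> v; apply: IH; apply: Ck_on_D.
Qed.

Lemma Ck_on_mul k U f g : open U -> Ck_on k U f -> Ck_on k U g -> Ck_on k U (fun x => f x * g x).
Proof.
move=> oU; elim: k f g => [|k IH] f g fk gk.
  by split=> // x Ux; apply: cvgM; [apply: Ck_on_cont fk Ux | apply: Ck_on_cont gk Ux].
apply: (Ck_onS oU (df := fun v x => 'D_v f x * g x + f x * 'D_v g x)).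
- by move=> x Ux; apply: cvgM; [apply: Ck_on_cont fk Ux | apply: Ck_on_cont gk Ux].
- by move=> v x Ux; apply: is_deriveMf; apply: Ck_on_derive Ux; eassumption.
- by move=> v; apply: Ck_on_add => //; apply: IH; (exact: Ck_on_D || exact: Ck_onW).
Qed.

Lemma Ck_on_inv k U f : open U -> (forall x, U x -> f x != 0) -> Ck_on k U f ->
  Ck_on k U (fun x => (f x)^-1).
Proof.
move=> oU f0; elim: k => [|k IH] fk.
  by split=> // x Ux; apply: cvgV; [exact: f0 | apply: Ck_on_cont fk Ux].
apply: (Ck_onS oU (df := fun v x => -1 * ((f x)^-1 * (f x)^-1) * 'D_v f x)).
- by move=> x Ux; apply: cvgV; [exact: f0 | apply: Ck_on_cont fk Ux].
- move=> v x Ux; apply: is_derive_eq (is_deriveVf (f0 x Ux) (Ck_on_derive v fk Ux)) _.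
  by rewrite mulN1r expr2 invfM.
- move=> v; have fV := IH (Ck_onW fk); apply: Ck_on_mul; [done | | exact: Ck_on_D].
  by apply: Ck_on_mul (Ck_on_mul oU fV fV) => //; apply: Ck_on_cst.
Qed.

Lemma Ck_on_sqrt k U f : open U -> (forall x, U x -> 0 < f x) -> Ck_on k U f ->
  Ck_on k U (fun x => Num.sqrt (f x)).
Proof.
move=> oU f0; elim: k => [|k IH] fk.
  split=> // x Ux; apply: continuous_comp; first exact: Ck_on_cont fk Ux.
  exact: sqrt_continuous.
apply: (Ck_onS oU (df := fun v x => (2 * Num.sqrt (f x))^-1 * 'D_v f x)).
- move=> x Ux; apply: continuous_comp; first exact: Ck_on_cont fk Ux.
  exact: sqrt_continuous.
- by move=> v x Ux; apply: is_derive_sqrtf (f0 x Ux) (Ck_on_derive v fk Ux).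
- move=> v; apply: Ck_on_mul; [done | | exact: Ck_on_D].
  apply: Ck_on_inv => // [x Ux|].
    by rewrite mulf_neq0 ?pnatr_eq0 // gt_eqF // sqrtr_gt0 f0.
  by apply: Ck_on_mul; [done | exact: Ck_on_cst | exact/IH/Ck_onW].
Qed.

Lemma elementary_Ck k U (F : tensor R 4 -> R) (phi : V -> tensor R 4) : open U ->
  elementary F -> (forall x, U x -> spin7_orbit (phi x)) ->
  (forall s, Ck_on k U (fun x => phi x s)) -> Ck_on k U (fun x => F (phi x)).
Proof.
move=> oU FE phiO phik; elim: FE => {F}.
- by [].
- by move=> c; apply: Ck_on_cst.
- by move=> f g _ fk _ gk; apply: Ck_on_add.
- by move=> f g _ fk _ gk; apply: Ck_on_mul.
- by move=> f _ fk f0; apply: Ck_on_inv => // x Ux; apply/f0/phiO.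
- by move=> f _ fk f0; apply: Ck_on_sqrt => // x Ux; apply/f0/phiO.
- by move=> f g _ fk fg; apply: Ck_on_eq fk => // x Ux; apply/fg/phiO.
Qed.
End Calculus.

(** The order of the quantifiers is the content: [D] depends only on the position [phi0] and the
    velocity [d], so two curves that share them have equal derivatives. The curve stays in the orbit
    near t, which allows identities valid only on the orbit to be differentiated. *)
Lemma elementary_is_derive (R : realType) (F : tensor R 4 -> R) (phi0 d : tensor R 4) :
  elementary F -> spin7_orbit phi0 ->
  exists D : R, forall (t : R) (phi : R -> tensor R 4), phi t = phi0 ->
    (\near t, spin7_orbit (phi t)) ->
    (forall s, is_derive t 1 (fun u => phi u s) (d s)) ->
    is_derive t 1 (fun u => F (phi u)) D.
Proof.
move=> FE phi0O; elim: FE => {F}.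
- by move=> s; exists (d s).
- by move=> c; exists 0 => *; exact: is_derive_cst.
- move=> f g _ [a fa] _ [b gb]; exists (a + b) => t phi E O phid.
  by apply: is_deriveDf; [apply: fa | apply: gb].
- move=> f g _ [a fa] _ [b gb]; exists (a * g phi0 + f phi0 * b) => t phi E O phid.
  by rewrite -E; apply: (is_deriveMf (f := fun u => f (phi u))); [apply: fa | apply: gb].
- move=> f _ [a fa] f0; exists (- (f phi0) ^- 2 * a) => t phi E O phid; rewrite -E.
  by apply: (is_deriveVf (f := fun u => f (phi u))); [rewrite E; apply: f0 | apply: fa].
- move=> f _ [a fa] f0; exists ((2 * Num.sqrt (f phi0))^-1 * a) => t phi E O phid; rewrite -E.
  by apply: (is_derive_sqrtf (f := fun u => f (phi u))); [rewrite E; apply: f0 | apply: fa].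
- move=> f g _ [a fa] fg; exists a => t phi E O phid.
  apply: near_eq_is_derive (fa t phi E O phid).
  by apply: filterS O => u; apply: fg.
Qed.

Section MixedPartials.
Variables (R : realType) (V : normedModType R).
Implicit Types (f : V -> R) (x v w z : V) (U : set V).

Lemma is_derive_along f z v (a d : R) : is_derive (a *: v + z) v f d ->
  is_derive a 1 (fun h : R => f (h *: v + z)) d.
Proof.
move=> /is_derive_line fd; pose F (h : R) := f (h *: v + (a *: v + z)).
have sd : is_derive a 1 (fun t : R => t - a) (1 - 0).
  exact: is_deriveBf (is_derive_id a 1) (is_derive_cst a a 1).
have := @is_derive1_comp R F (fun t => t - a) a d (1 - 0); rewrite subrr => /(_ fd sd).
rewrite subr0 mulr1; congr is_derive; apply/funext => h /=.
by rewrite /F addrA -scalerDl subrK.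
Qed.

(** The mean value theorem along v for the difference of f across the step h w, then along w for the
    derivative of f in direction v. *)
Lemma second_difference U f x v w (h : R) : Ck_on 2 U f -> 0 < h ->
  (forall a b, 0 <= a <= h -> 0 <= b <= h -> U (a *: v + (b *: w + x))) ->
  exists a b, [/\ 0 <= a <= h, 0 <= b <= h &
    f (h *: v + (h *: w + x)) - f (h *: v + x) - (f (h *: w + x) - f x) =
    'D_w (fun y => 'D_v f y) (a *: v + (b *: w + x)) * (h * h)].
Proof.
move=> f2 h0 hU; have h00 : 0 <= (0 : R) <= h by rewrite lexx ltW.
have hh : 0 <= h <= h by rewrite lexx ltW.
pose k (a : R) := f (a *: v + (h *: w + x)) - f (a *: v + x).
pose dk (a : R) := 'D_v f (a *: v + (h *: w + x)) - 'D_v f (a *: v + x).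
have hU0 a : 0 <= a <= h -> U (a *: v + x).
  by move=> ah; have := hU a 0 ah h00; rewrite scale0r add0r.
have kd a : 0 <= a <= h -> is_derive a 1 k (dk a).
  move=> ah; apply: is_deriveBf; apply: is_derive_along; apply: Ck_on_derive f2 _.
    exact: hU.
  exact: hU0.
have [||a /itvP ah] := @MVT R k dk 0 h h0.
- by move=> a ah; apply: kd; rewrite !ltW ?(itvP ah).
- apply: (@derivable_within_continuous _ _ k `[0, h]) => a ah.
  by have [] : is_derive a 1 k (dk a) by apply: kd; rewrite !(itvP ah).
rewrite subr0 => kE; have {}ah : 0 <= a <= h by rewrite !ah.
pose l (b : R) := 'D_v f (b *: w + (a *: v + x)).
pose dl (b : R) := 'D_w (fun y => 'D_v f y) (b *: w + (a *: v + x)).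
have ld b : 0 <= b <= h -> is_derive b 1 l (dl b).
  move=> bh; apply: (is_derive_along (f := fun y => 'D_v f y)).
  apply: (Ck_on_derive (U := U) (k := 0)).
    exact: (Ck_on_D (k := 1)).
  by rewrite addrCA; apply: hU.
have [||b /itvP bh] := @MVT R l dl 0 h h0.
- by move=> b bh; apply: ld; rewrite !ltW ?(itvP bh).
- apply: (@derivable_within_continuous _ _ l `[0, h]) => b bh.
  by have [] : is_derive b 1 l (dl b) by apply: ld; rewrite !(itvP bh).
rewrite subr0 => lE; exists a, b; split=> //; first by rewrite !bh.
move: kE lE; rewrite /k /dk /l /dl !scale0r !add0r => ->.
by rewrite !(addrCA _ (a *: v)) => ->; rewrite mulrA.
Qed.

(** The second difference is symmetric in v and w, so the two mixed derivatives agree at some pair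
    of points of every small parallelogram at x; continuity excludes a gap at x. *)
Lemma Ck_on_derive_comm U f x v w : open U -> Ck_on 2 U f -> U x ->
  'D_v (fun y => 'D_w f y) x = 'D_w (fun y => 'D_v f y) x.
Proof.
move=> oU f2 Ux; set D1 := fun y => 'D_v (fun y => 'D_w f y) y.
set D2 := fun y => 'D_w (fun y => 'D_v f y) y; rewrite -/(D1 x) -/(D2 x).
have D1c : D1 @ x --> D1 x.
  by apply: (Ck_on_cont (k := 0)) Ux; apply: (Ck_on_D (k := 0)); apply: (Ck_on_D (k := 1)).
have D2c : D2 @ x --> D2 x.
  by apply: (Ck_on_cont (k := 0)) Ux; apply: (Ck_on_D (k := 0)); apply: (Ck_on_D (k := 1)).
apply/eqP; rewrite -subr_eq0 -normr_le0 leNgt; apply/negP => e0.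
set e := `|_| in e0; have e20 : 0 < e / 2 by rewrite divr_gt0.
have NU : nbhs x U by apply: open_nbhs_nbhs.
have N1 : \forall y \near x, `|D1 x - D1 y| < e / 2.
  by move/cvgrPdist_lt : D1c => /(_ _ e20).
have N2 : \forall y \near x, `|D2 x - D2 y| < e / 2.
  by move/cvgrPdist_lt : D2c => /(_ _ e20).
have /nbhs_ballP[r /= r0 rP] : \forall y \near x,
    [/\ U y, `|D1 x - D1 y| < e / 2 & `|D2 x - D2 y| < e / 2].
  exact: filterS3 (fun y => @And3 _ _ _) NU N1 N2.
(* This keeps the whole parallelogram inside the ball of radius r; the summand 1 covers v = w =
   0. *)
pose h := r / (2 * (`|v| + `|w| + 1)).
have vw0 : 0 < `|v| + `|w| + 1 by rewrite ltr_wpDl ?addr_ge0.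
have h0 : 0 < h by rewrite divr_gt0 // mulr_gt0.
have hP a b : 0 <= a <= h -> 0 <= b <= h ->
    [/\ U (a *: v + (b *: w + x)), `|D1 x - D1 (a *: v + (b *: w + x))| < e / 2 &
        `|D2 x - D2 (a *: v + (b *: w + x))| < e / 2].
  move=> /andP[a0 ah] /andP[b0 bh]; apply: rP; rewrite -ball_normE /=.
  rewrite distrC addrA addrK; apply: le_lt_trans (ler_normD _ _) _; rewrite !normrZ !ger0_norm //.
  apply: (@le_lt_trans _ _ (h * (`|v| + `|w|))).
    by rewrite mulrDr lerD // ler_wpM2r.
  rewrite /h mulrAC ltr_pdivrMr ?mulr_gt0 // ltr_pM2l //.
  have : 0 <= `|v| + `|w| by rewrite addr_ge0.
  by move: (`|v| + `|w|) => s; lra.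
have [a [b [ah bh E1]]] := second_difference f2 h0 (fun a b ah bh => let: And3 Uab _ _ := hP a b ah bh in Uab).
have [|b' [a' [bh' ah' E2]]] := @second_difference U f x w v h f2 h0.
  by move=> b' a' bh' ah'; rewrite addrCA; case: (hP a' b').
have hh0 : h * h != 0 by rewrite mulf_neq0 ?gt_eqF.
have E : D2 (a *: v + (b *: w + x)) = D1 (a' *: v + (b' *: w + x)).
  apply: (mulIf hh0); rewrite (addrCA (a' *: v)); apply: (etrans (esym E1)).
  apply: etrans E2; rewrite [in RHS]addrCA.
  have AC (p q s t : R) : p - q - (s - t) = p - s - (q - t) by ring.
  exact: AC.
have [_ _ lt2] := hP _ _ ah bh; have [_ lt1 _] := hP _ _ ah' bh'.
rewrite E distrC in lt2.
have le12 := ler_distD (D1 (a' *: v + (b' *: w + x))) (D1 x) (D2 x).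
have := le_lt_trans le12 (ltrD lt1 lt2).
by rewrite -splitr ltxx.
Qed.
End MixedPartials.

(** * Contractions in arbitrary coordinates *)

Definition mx2 (R : Type) (b : tensor R 2) : 'M[R]_8 := \matrix_(i, j) b [tuple i; j].

Section Pointwise.
Variables (R : realType) (phi : tensor R 4).
Implicit Types (B N : 'M[R]_8) (b : tensor R 2).

Definition ctr2 (F : tensor R 4) N : 'M[R]_8 :=
  \matrix_(i, j) \sum_p \sum_q N p q * F [tuple p; q; i; j].

Lemma ctr2D F N N' : ctr2 F (N + N') = ctr2 F N + ctr2 F N'.
Proof.
apply/matrixP => i j; rewrite !mxE -big_split; apply: eq_bigr => p _ /=.
by rewrite -big_split; apply: eq_bigr => q _; rewrite mxE mulrDl.
Qed.

Lemma ctr2N F N : ctr2 F (- N) = - ctr2 F N.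
Proof.
apply/matrixP => i j; rewrite !mxE -sumrN; apply: eq_bigr => p _ /=.
by rewrite -sumrN; apply: eq_bigr => q _; rewrite mxE mulNr.
Qed.

(** The two contracted slots pass to N by transposition, and the two free slots act on the result
    from either side. *)
Lemma ctr2_der B F N :
  ctr2 (der B F) N = ctr2 F (B^T *m N + N *m B) + B *m ctr2 F N + ctr2 F N *m B^T.
Proof.
rewrite ctr2D; apply/matrixP => i j; rewrite [RHS]mxE [in RHS]mxE.
rewrite mxE; under eq_bigr => p _ do under eq_bigr => q _ do rewrite derE4 !mulrDr.
under eq_bigr => p _ do rewrite !big_split.
rewrite !big_split !mxE; do !congr (_ + _).
- under eq_bigr => p _ do under eq_bigr => q _ do rewrite mulr_sumr.
  under eq_bigr => p _ do rewrite exchange_big /=.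
  rewrite exchange_big; apply: eq_bigr => n _ /=; rewrite exchange_big; apply: eq_bigr => q _ /=.
  by rewrite mxE mulr_suml; apply: eq_bigr => p _; rewrite mxE mulrCA mulrA.
- apply: eq_bigr => p _; under eq_bigr => q _ do rewrite mulr_sumr.
  rewrite exchange_big; apply: eq_bigr => n _ /=.
  by rewrite mxE mulr_suml; apply: eq_bigr => q _; rewrite mulrA.
- under eq_bigr => p _ do under eq_bigr => q _ do rewrite mulr_sumr.
  under eq_bigr => p _ do rewrite exchange_big /=.
  rewrite exchange_big; apply: eq_bigr => n _ /=; rewrite mxE mulr_sumr.
  apply: eq_bigr => p _; rewrite mulr_sumr; apply: eq_bigr => q _; exact: mulrCA.
- under eq_bigr => p _ do under eq_bigr => q _ do rewrite mulr_sumr.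
  under eq_bigr => p _ do rewrite exchange_big /=.
  rewrite exchange_big; apply: eq_bigr => n _ /=; rewrite !mxE mulr_suml.
  apply: eq_bigr => p _; rewrite mulr_suml; apply: eq_bigr => q _.
  by rewrite mulrCA mulrC.
Qed.

Hypothesis phiO : spin7_orbit phi.
Let g := metric phi.
Let G := metric_inv phi.

Lemma metric_tr : g^T = g.
Proof. by rewrite /g /metric trmx_mul trmxK. Qed.

Lemma metric_invK : G *m g = 1%:M.
Proof. by rewrite mulVmx // metric_unit. Qed.

Lemma metricK : g *m G = 1%:M.
Proof. by rewrite mulmxV // metric_unit. Qed.

Lemma metric_inv_tr : G^T = G.
Proof. by rewrite /G /metric_inv trmx_inv metric_tr. Qed.

(** The factor 1/2 in [hodge_wedge] turns the eigenvalue -3 into -6. *)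
Lemma Omega2_7P b : Omega2_7 phi b ->
  (mx2 b)^T = - mx2 b /\ ctr2 phi (G *m mx2 b *m G) = - 6 *: mx2 b.
Proof.
have [eU phiE] := adapted_coframeP phiO.
move=> [bskew bstar]; split; first by apply/matrixP => i j; rewrite !mxE bskew.
apply/matrixP => i j; have := congr1 (fun F => F [tuple i; j]) bstar.
rewrite (hodge_wedge eU _ _ phiE) -/(metric phi) -/(metric_inv phi) -/G !mxE.
move=> /(congr1 ( *%R 2)); rewrite mulrA mulfV ?pnatr_eq0 // mul1r.
have -> : 2 * (-3 * b [tuple i; j]) = -6 * b [tuple i; j].
  by move: (b _) => y; ring.
move=> <-; rewrite sum_tupleS; apply: eq_bigr => p _; rewrite sum_tupleS; apply: eq_bigr => q _.
rewrite sum_tuple0; congr (_ * phi _); last exact: val_inj.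
rewrite /pull sum_tupleS !mxE.
under eq_bigr => x _ do rewrite mxE mulr_suml.
rewrite exchange_big; apply: eq_bigr => x _; rewrite sum_tupleS; apply: eq_bigr => y _.
rewrite sum_tuple0 !big_ord_recl big_ord0 mulr1 /= !mxE mulrAC; congr (_ * _ * _) => //.
  by rewrite -[in RHS]metric_inv_tr mxE.
Qed.

Lemma diamondE b i j k l : diamond phi b i j k l = der (mx2 b *m G) phi [tuple i; j; k; l].
Proof.
rewrite derE4 /diamond exchange_big -/G /=.
have E (c : 'I_8) (F : 'I_8 -> R) : \sum_p (mx2 b *m G) c p * F p =
   \sum_p \sum_m G m p * (b [tuple c; m] * F p).
  apply: eq_bigr => p _; rewrite mxE mulr_suml; apply: eq_bigr => m _.
  by rewrite !mxE [_ * G _ _]mulrC mulrA.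
rewrite !E -!big_split; apply: eq_bigr => p _; rewrite -!big_split; apply: eq_bigr => m _ /=.
by rewrite !mulrDr.
Qed.

Lemma pi7E (b : 'I_8 -> 'I_8 -> R) i j :
  pi7 phi b i j = (4^-1 *: (\matrix_(i, j) b i j) -
                   8^-1 *: ctr2 phi (G *m (\matrix_(i, j) b i j) *m G)) i j.
Proof.
rewrite /pi7 -/G !mxE; congr (_ - _ * _).
under eq_bigr => a _ do under eq_bigr => c _ do rewrite exchange_big.
under eq_bigr => a _ do rewrite exchange_big /=.
rewrite exchange_big.
under eq_bigr => q _ do under eq_bigr => a _ do rewrite exchange_big /=.
under eq_bigr => q _ do rewrite exchange_big /=.
rewrite exchange_big; apply: eq_bigr => p _; apply: eq_bigr => q _ /=.
rewrite mxE mulr_suml exchange_big; apply: eq_bigr => c _ /=.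
rewrite mxE !mulr_suml; apply: eq_bigr => a _; congr (_ * _).
by rewrite mxE -{1}metric_inv_tr mxE [G p a * _]mulrC.
Qed.

Lemma contract_diamond B i j : B^T = - B ->
  ctr3 G (der (B *m G) phi) phi i j = (24 *: B - 12 *: ctr2 phi (G *m B *m G)) i j.
Proof.
have [eU phiE] := adapted_coframeP phiO.
by move=> Bskew; rewrite (contract_der eU phiE) // !mxE.
Qed.

(** [contract_diamond] divided by 96; the conclusion says that pi_7 kills B. *)
Lemma der_diamond_eq0 B : B^T = - B -> (forall s, der (B *m G) phi s = 0) ->
  4^-1 *: B = 8^-1 *: ctr2 phi (G *m B *m G).
Proof.
move=> Bskew B0; apply/matrixP => i j; have := contract_diamond i j Bskew.
have -> : ctr3 G (der (B *m G) phi) phi i j = 0.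
  rewrite /ctr3 big1 // => t _; rewrite big1 // => u _.
  by rewrite B0 mulr0 mul0r.
rewrite !mxE; move: (B i j) (\sum_p _) => x y; lra.
Qed.
End Pointwise.

(** * Variation of the metric *)

Section Families.
Variables (R : realType) (V : normedModType R) (x v : V).

Lemma is_derive_unique (f : V -> R) a b : is_derive x v f a -> is_derive x v f b -> a = b.
Proof. by move=> [_ <-] [_ <-]. Qed.

Lemma is_derive_prodf n (F : 'I_n -> V -> R) (a : 'I_n -> R) :
  (forall q, is_derive x v (F q) (a q)) ->
  is_derive x v (fun y => \prod_q F q y) (\sum_r a r * \prod_(q | q != r) F q x).
Proof.
elim: n F a => [|n IH] F a Fa.
  rewrite big_ord0 (_ : (fun y => _) = cst 1); first exact: is_derive_cst.
  by apply/funext => y; rewrite big_ord0.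
rewrite (_ : (fun y => _) = fun y => F ord0 y * \prod_(q < n) F (lift ord0 q) y); last first.
  by apply/funext => y; rewrite big_ord_recl.
apply: is_derive_eq (is_deriveMf (Fa ord0) (IH _ _ (fun q => Fa (lift ord0 q)))) _.
rewrite big_ord_recl; congr (_ * _ + _).
  by rewrite [RHS]big_mkcond big_ord_recl /= mul1r; apply: eq_bigr => q _.
rewrite mulr_sumr; apply: eq_bigr => r _; rewrite mulrCA; congr (_ * _).
rewrite [in RHS]big_mkcond big_ord_recl /=; congr (_ * _).
rewrite big_mkcond; apply: eq_bigr => q _; by rewrite (inj_eq (@lift_inj _ ord0)).
Qed.

(** Derivatives are taken componentwise, so no norm on tensors is involved. *)
Definition mder (M : V -> 'M[R]_8) (dM : 'M[R]_8) :=
  forall i j, is_derive x v (fun y => M y i j) (dM i j).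
Definition tder n (F : V -> tensor R n) (dF : tensor R n) :=
  forall s, is_derive x v (fun y => F y s) (dF s).

Lemma mder_unique M dM dM' : mder M dM -> mder M dM' -> dM = dM'.
Proof. by move=> H H'; apply/matrixP => i j; apply: is_derive_unique (H i j) (H' i j). Qed.

Lemma mder_near M N dM : (\near x, M x = N x) -> mder M dM -> mder N dM.
Proof.
move=> MN dH i j; apply: near_eq_is_derive (dH i j).
by apply: filterS MN => y ->.
Qed.

Lemma mder_cst M : mder (fun=> M) 0.
Proof. by move=> i j; rewrite mxE; apply: is_derive_cst. Qed.

Lemma mderD M N dM dN : mder M dM -> mder N dN -> mder (fun y => M y + N y) (dM + dN).
Proof.
move=> MH NH i j; rewrite mxE (_ : (fun y => _) = fun y => M y i j + N y i j).
  exact: is_deriveDf.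
by apply/funext => y; rewrite mxE.
Qed.

Lemma mderZ c M dM : mder M dM -> mder (fun y => c *: M y) (c *: dM).
Proof.
move=> MH i j; rewrite mxE (_ : (fun y => _) = fun y => c * M y i j).
  exact: is_deriveZf.
by apply/funext => y; rewrite mxE.
Qed.

Lemma mderT M dM : mder M dM -> mder (fun y => (M y)^T) dM^T.
Proof.
move=> MH i j; rewrite mxE (_ : (fun y => _) = fun y => M y j i) //.
by apply/funext => y; rewrite mxE.
Qed.

Lemma mderM M N dM dN : mder M dM -> mder N dN ->
  mder (fun y => M y *m N y) (dM *m N x + M x *m dN).
Proof.
move=> MH NH i j; rewrite !mxE -big_split (_ : (fun y => _) = fun y => \sum_k M y i k * N y k j).
  by apply: is_derive_sumf => k; apply: is_deriveMf.
by apply/funext => y; rewrite mxE.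
Qed.

(** The value comes from differentiating G g = 1. Differentiability of G is an input, to be supplied
    by the expression of the inverse metric in the form. *)
Lemma mder_inv (g G : V -> 'M[R]_8) dg dG : (\near x, G x *m g x = 1%:M) -> g x *m G x = 1%:M ->
  mder g dg -> mder G dG -> mder G (- (G x *m dg *m G x)).
Proof.
move=> Gg gG gH GH; suff <- : dG = - (G x *m dg *m G x) by [].
have E : dG *m g x + G x *m dg = 0.
  apply: (mder_unique (mderM GH gH)); apply: mder_near (mder_cst 1%:M).
  by apply: filterS Gg => y ->.
by rewrite -[dG]mulmx1 -gG mulmxA -(addrK (G x *m dg) (dG *m _)) E add0r mulNmx.
Qed.

Lemma tder_der n B (F : V -> tensor R n) dB dF : mder B dB -> tder F dF ->
  tder (fun y => der (B y) (F y)) (fun s => der dB (F x) s + der (B x) dF s).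
Proof.
move=> BH FH s; rewrite /der -big_split; apply: is_derive_sumf => r.
rewrite -big_split; apply: is_derive_sumf => p.
exact: is_deriveMf.
Qed.

Lemma mder_ctr2 N (F : V -> tensor R 4) dN dF : mder N dN -> tder F dF ->
  mder (fun y => ctr2 (F y) (N y)) (ctr2 (F x) dN + ctr2 dF (N x)).
Proof.
move=> NH FH i j; rewrite !mxE (_ : (fun y => _) =
  fun y => \sum_p \sum_q N y p q * F y [tuple p; q; i; j]); last first.
  by apply/funext => y; rewrite mxE.
rewrite -big_split; apply: is_derive_sumf => p; rewrite -big_split; apply: is_derive_sumf => q.
exact: is_deriveMf.
Qed.

Lemma ctr3_derivable G dG (Z H : V -> tensor R 4) dZ dH i j :
  mder G dG -> tder Z dZ -> tder H dH ->
  exists d, is_derive x v (fun y => ctr3 (G y) (Z y) (H y) i j) d.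
Proof.
move=> GH ZH HH; eexists; rewrite /ctr3.
apply: is_derive_sumf => t; apply: is_derive_sumf => u.
apply: is_deriveMf; last exact: HH.
apply: is_deriveMf; last exact: ZH.
by apply: is_derive_prodf => r; apply: GH.
Qed.
End Families.

Section MetricVariation.
Variable R : realType.

(** The product rule slot by slot, read through [der_pullE]: the velocity of the coframe acts on its
    pullbacks as a derivation. *)
Lemma tder_pull (V : normedModType R) (x v : V) n (e : V -> 'M[R]_8) de B (F : tensor R n) :
  mder x v e de -> B *m (e x)^T = de^T -> 
  tder x v (fun y => pull (e y) F) (der B (pull (e x) F)).
Proof.
move=> eH BE s; rewrite der_pullE BE; apply: is_derive_sumf => t.
have := @is_derive_prodf R V x v n (fun q y => e y (tnth t q) (tnth s q)) _ (fun q => eH _ _).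
move=> /is_deriveMf /(_ (is_derive_cst (F t) x v)) H.
apply: is_derive_eq H _; rewrite mulr0 addr0; congr (_ * _).
by apply: eq_bigr => r _; rewrite mxE.
Qed.

Lemma det_continuous (e : R -> 'M[R]_8) (de : 'M[R]_8) (x : R) : mder x 1 e de ->
  {for x, continuous (fun y => \det (e y))}.
Proof.
move=> eH; suff [d H] : exists d, is_derive x 1 (fun y => \det (e y)) d.
  by apply/differentiable_continuous/derivable1_diffP; case: H.
eexists; rewrite /determinant; apply: is_derive_sumf => w; apply: is_deriveZf.
by apply: is_derive_prodf => q; apply: eH.
Qed.

(* The derivative of the metric along a curve of structures only depends on the
   velocity of the curve, so it may be computed along a curve of coframes. *)
Lemma metric_is_derive (t : R) (phi : R -> tensor R 4) (A : 'M[R]_8) :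
  (\near t, spin7_orbit (phi t)) ->
  tder t 1 phi (der (A *m metric_inv (phi t)) (phi t)) ->
  mder t 1 (fun u => metric (phi u)) (A + A^T).
Proof.
move=> O phid i j; have tO : spin7_orbit (phi t) := nbhs_singleton O.
have [eU phiE] := adapted_coframeP tO; set e := adapted_coframe (phi t) in eU phiE.
set G := metric_inv (phi t) in phid *; set g := metric (phi t).
(* The choice B = (A G)^T makes (E')^T = A G e^T, which is what [tder_pull] needs for the velocity
   [der (A G)]. The curve is affine, so it consists of coframes only near 0. *)
pose B := G *m A^T; pose E (s : R) := e + s *: (e *m B).
have E0 : E 0 = e by rewrite /E scale0r addr0.
have Ed : mder (0 : R) 1 E (e *m B).
  rewrite -[e *m B]add0r; apply: mderD; first exact: mder_cst.
  move=> a b; rewrite (_ : (fun s => _) = fun s : R => s * (e *m B) a b); last first.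
    by apply/funext => s; rewrite mxE.
  have := is_deriveMf (is_derive_id (0 : R) 1) (is_derive_cst ((e *m B) a b) (0 : R) 1).
  by rewrite mul1r mulr0 addr0.
pose psi s := spin7_form (E s).
have [D DH] := elementary_is_derive (der (A *m G) (phi t)) (elementary_metric R i j) tO.
have H1 := DH t phi erefl O phid.
have EU : \forall s \near (0 : R), E s \in unitmx.
  have : \forall s \near (0 : R), \det (E s) != 0.
    have cE : (fun s => \det (E s)) @ (0 : R) --> \det (E 0) by exact: det_continuous Ed.
    by move/cvgr_neq0 : cE; apply; rewrite E0 -unitfE -unitmxE.
  by apply: filterS => s; rewrite unitmxE unitfE.
have H2 : is_derive (0 : R) 1 (fun s => metric (psi s) i j) D.
  apply: DH.
  - by apply/funext => s; rewrite /psi E0 spin7_formE phiE.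
  - by apply: filterS EU => s sU; exists (E s).
  - move=> s; rewrite /psi (_ : (fun u => _) = fun u => pull (E u) (stdr R) s); last first.
      by apply/funext => u; rewrite spin7_formE.
    have -> : der (A *m G) (phi t) s = der (A *m G) (pull (E 0) (stdr R)) s.
      by rewrite E0; apply: eq_der.
    apply: tder_pull Ed _ _; rewrite E0 /B !trmx_mul trmxK metric_inv_tr.
    by [].
have H3 : is_derive (0 : R) 1 (fun s => metric (psi s) i j)
    ((((e *m B)^T *m e) + (e^T *m (e *m B))) i j).
  have H := mderM (mderT Ed) Ed; rewrite E0 in H.
  apply: near_eq_is_derive (H i j); apply: filterS EU => s sU.
  by rewrite (@metric_adapted _ (psi s) (E s)).
have <- : D = (A + A^T) i j; last exact: H1.
rewrite (is_derive_unique H2 H3) mulmxA -/(metric (phi t)) -/g trmx_mul -mulmxA -/(metric (phi t)).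
by rewrite -/g /B trmx_mul trmxK metric_inv_tr -mulmxA (metric_invK tO) mulmx1 mulmxA (metricK tO) mul1mx.
Qed.
End MetricVariation.

(** * Partial derivatives in time and space *)

Lemma open_setX (S T : topologicalType) (A : set S) (B : set T) :
  open A -> open B -> open (A `*` B).
Proof.
move=> oA oB; rewrite openE => -[a b] [/= Aa Bb].
by exists (A, B) => //=; split; apply: open_nbhs_nbhs.
Qed.

Section Partial.
Variables (R : realType) (V : normedModType R).
Implicit Types (F : R * V -> R) (t d : R) (x e : V).

Lemma is_derive_fst F t x d :
  is_derive (t, x) ((1 : R), (0 : V)) F d <-> is_derive t 1 (fun u => F (u, x)) d.
Proof.
have E : (fun h : R => F (h *: ((1 : R), (0 : V)) + (t, x))) =
         (fun h : R => (fun u => F (u, x)) (h *: (1 : R) + t)).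
  apply/funext => h /=; congr F.
  by apply/pair_equal_spec; split=> //=; rewrite scaler0 add0r.
by split=> /is_derive_line H; apply/is_derive_line; [rewrite -E | rewrite E].
Qed.

Lemma is_derive_snd F t x e d :
  is_derive (t, x) ((0 : R), e) F d <-> is_derive x e (fun y => F (t, y)) d.
Proof.
have E : (fun h : R => F (h *: ((0 : R), e) + (t, x))) =
         (fun h : R => (fun y => F (t, y)) (h *: e + x)).
  apply/funext => h /=; congr F.
  by apply/pair_equal_spec; split=> //=; rewrite scaler0 add0r.
by split=> /is_derive_line H; apply/is_derive_line; [rewrite -E | rewrite E].
Qed.

Variables (J : set R) (U : set V) (F : R * V -> R).
Hypotheses (oJ : open J) (oU : open U) (F2 : Ck_on 2 (J `*` U) F).

Lemma is_derive_slice t x e : J t -> U x ->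
  is_derive x e (fun y => F (t, y)) ('D_((0 : R), e) F (t, x)).
Proof. by move=> Jt Ux; apply/is_derive_snd; apply: Ck_on_derive F2 _. Qed.

(** Symmetry of second derivatives for the directions (1, 0) and (0, e). The velocity [dF] is given
    on U only, so it is first identified there with the derivative of F along (1, 0). *)
Lemma is_derive_mixed t x e (dF : V -> R) : J t -> U x ->
  (forall y, U y -> is_derive t 1 (fun u => F (u, y)) (dF y)) ->
  is_derive t 1 (fun u => 'D_e (fun y => F (u, y)) x) ('D_e dF x).
Proof.
move=> Jt Ux dFt; have oJU : open (J `*` U) by apply: open_setX.
pose F1 := fun z => 'D_((0 : R), e) F z; pose F0 := fun z => 'D_((1 : R), (0 : V)) F z.
have F11 : Ck_on 1 (J `*` U) F1 by apply: (Ck_on_D (k := 1)).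
have F01 : Ck_on 1 (J `*` U) F0 by apply: (Ck_on_D (k := 1)).
have H : is_derive t 1 (fun u => F1 (u, x)) ('D_((1 : R), (0 : V)) F1 (t, x)).
  by apply/is_derive_fst; apply: Ck_on_derive F11 _.
have -> : 'D_e dF x = 'D_((1 : R), (0 : V)) F1 (t, x).
  rewrite /F1 (Ck_on_derive_comm _ _ oJU F2) // -/F0.
  have /is_derive_snd[_ <-] : is_derive (t, x) ((0 : R), e) F0 ('D_((0 : R), e) F0 (t, x)).
    by apply: Ck_on_derive F01 _.
  apply: near_eq_derive; apply: (open_near_eq oU Ux) => y Uy.
  have : is_derive (t, y) ((1 : R), (0 : V)) F (F0 (t, y)) by apply: Ck_on_derive F2 _.
  by move=> /is_derive_fst H0; apply: is_derive_unique (dFt y Uy) H0.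
apply: near_eq_is_derive H; apply: (open_near_eq oJ Jt) => u Ju.
by have [_ E] := is_derive_slice e Ju Ux; rewrite /F1 -E.
Qed.
End Partial.

(** * Variation of the torsion *)

Section Source.
Variables (R : realType) (g G h X : 'M[R]_8) (dg dh dX : 'I_8 -> 'M[R]_8).
Hypotheses (gG : g *m G = 1%:M) (Gg : G *m g = 1%:M).
Hypotheses (gT : g^T = g) (hT : h^T = h).
Hypotheses (dgT : forall k, (dg k)^T = dg k) (dhT : forall k, (dh k)^T = dh k).

(** Twice the Christoffel symbols of the first kind, for an arbitrary array [D] because it serves
    both the metric and its time derivative 2 h. *)
Definition lowered_christoffel (D : 'I_8 -> 'M[R]_8) (m : 'I_8) : 'M[R]_8 :=
  \matrix_(i, q) (D m i q + D i m q - D q m i).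
(** The upper index is the column: [gamma m i p] is Gamma^p_(m i), so that nabla_m is the partial
    derivative minus [der (gamma m)]. *)
Definition gamma (m : 'I_8) : 'M[R]_8 := 2^-1 *: (lowered_christoffel dg m *m G).
Definition cov (m : 'I_8) (b db : 'M[R]_8) := db - gamma m *m b - b *m (gamma m)^T.

Lemma gamma_sym m i p : gamma m i p = gamma i m p.
Proof.
rewrite !mxE; congr (_ * _); apply: eq_bigr => q _; rewrite !mxE; congr (_ * _).
have -> : dg q m i = dg q i m by rewrite -[in LHS]dgT mxE.
ring.
Qed.

Lemma lowered_christoffelE m : lowered_christoffel dg m = 2 *: (gamma m *m g).
Proof. by rewrite /gamma -scalemxAl -mulmxA Gg mulmx1 scalerA mulfV ?pnatr_eq0 // scale1r. Qed.

Lemma metric_compat m : dg m = gamma m *m g + g *m (gamma m)^T.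
Proof.
have E : gamma m *m g = 2^-1 *: lowered_christoffel dg m.
  by rewrite lowered_christoffelE scalerA mulVf ?pnatr_eq0 // scale1r.
have -> : g *m (gamma m)^T = (gamma m *m g)^T by rewrite trmx_mul gT.
rewrite E; apply/matrixP => i q; rewrite !mxE.
have -> : dg m q i = dg m i q by rewrite -[in LHS]dgT mxE.
by field.
Qed.

Lemma der_metric_inv m : - (G *m dg m *m G) = - (G *m gamma m) - (gamma m)^T *m G.
Proof.
rewrite (metric_compat m) mulmxDr mulmxDl opprD; congr (- _ - _).
  by rewrite -!mulmxA gG mulmx1.
by rewrite !mulmxA Gg mul1mx.
Qed.

(** The product rule for [gamma] when g' = 2 h and G' = - 2 G h G. *)
Definition dgamma (m : 'I_8) : 'M[R]_8 :=
  2^-1 *: (lowered_christoffel (fun k => 2 *: dh k) m *m G +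
           lowered_christoffel dg m *m (- (G *m (2 *: h) *m G))).

(** The left side is nabla_m (A G) minus the variation of the connection. As G is parallel, the
    first is (nabla_m A) G; the second is G applied to nabla_m h_(ab) + nabla_a h_(mb) - nabla_b
    h_(ma). The terms nabla_m h cancel, which is the origin of the argument of pi_7. *)
Lemma torsion_source (m : 'I_8) (S : 'M[R]_8) :
  S = \matrix_(a, b) (cov b h (dh b) a m - cov a h (dh a) b m + cov m X (dX m) a b) ->
  let A := h + X in
  (dh m + dX m) *m G + A *m (- (G *m dg m *m G)) + (A *m G *m gamma m - gamma m *m (A *m G))
  - dgamma m = S *m G.
Proof.
move=> -> A; rewrite der_metric_inv.
have -> : dgamma m = (lowered_christoffel dh m - 2 *: (gamma m *m h)) *m G.
  rewrite /dgamma lowered_christoffelE scalerDr; rewrite mulmxBl; congr (_ + _).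
    rewrite scalemxAl; congr (_ *m _); apply/matrixP => i q; rewrite !mxE; by field.
  rewrite mulmxN -scalemxAl -[G *m (2 *: h)]scalemxAr -[(2 *: _) *m G]scalemxAl.
  rewrite -[gamma m *m g *m _]scalemxAr !mulmxA -(mulmxA _ g G) gG mulmx1 ?mulNmx -[X in _ = - X]scalemxAl.
  rewrite scalerN !scalerA; congr (- (_ *: _)); by field.
transitivity ((cov m A (dh m + dX m) - (lowered_christoffel dh m - 2 *: (gamma m *m h))) *m G).
  rewrite [RHS]mulmxBl; congr (_ - _); rewrite /cov !mulmxBl mulmxBr mulmxN !mulmxA.
  move: ((dh m + dX m) *m G) (A *m G *m gamma m) (A *m (gamma m)^T *m G) (gamma m *m A *m G).
  by move=> q0 q1 q2 q3; apply/matrixP => i j; rewrite !mxE; ring.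
congr (_ *m G); apply/matrixP => a b; rewrite /cov /A.
have hE i j : h i j = h j i by rewrite -[in LHS]hT mxE.
have dhE k i j : dh k i j = dh k j i by rewrite -[in LHS]dhT mxE.
(* The Christoffel terms match in pairs by symmetry of the lower indices and of h. *)
have g1 : (gamma b *m h) a m = (gamma a *m h) b m.
  by rewrite !mxE; apply: eq_bigr => p _; rewrite gamma_sym.
have g2 : (h *m (gamma b)^T) a m = (h *m (gamma m)^T) a b.
  by rewrite !mxE; apply: eq_bigr => p _; rewrite ![(gamma _)^T _ _]mxE gamma_sym.
have g3 : (h *m (gamma a)^T) b m = (gamma m *m h) a b.
  rewrite !mxE; apply: eq_bigr => p _; rewrite ![(gamma _)^T _ _]mxE gamma_sym hE.
  by rewrite mulrC.
have g4 : ((h + X) *m (gamma m)^T) a b = (h *m (gamma m)^T) a b + (X *m (gamma m)^T) a b.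
  by rewrite mulmxDl mxE.
have g5 : (gamma m *m (h + X)) a b = (gamma m *m h) a b + (gamma m *m X) a b.
  by rewrite mulmxDr mxE.
have subE (M N : 'M[R]_8) i j : (M - N) i j = M i j - N i j by rewrite !mxE.
have addE (M N : 'M[R]_8) i j : (M + N) i j = M i j + N i j by rewrite !mxE.
have scE (M : 'M[R]_8) c i j : (c *: M) i j = c * M i j by rewrite !mxE.
rewrite [RHS]mxE !subE addE scE g4 g5 g1 g2 g3 [lowered_christoffel _ _ _ _]mxE.
rewrite (dhE a b m) (dhE b m a).
move: (dh m a b) (dh a m b) (dh b a m) (dX m a b) ((gamma m *m h) a b).
move: ((h *m (gamma m)^T) a b) ((gamma m *m X) a b) ((X *m (gamma m)^T) a b) ((gamma a *m h) b m).
by move=> q1 q2 q3 q4 q5 q6 q7 q8 q9; ring.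
Qed.
End Source.

Section Variation.
Variable R : realType.

Lemma mder_ex (V : normedModType R) (x v : V) (M : V -> 'M[R]_8) :
  (forall i j, exists d, is_derive x v (fun y => M y i j) d) -> exists dM, mder x v M dM.
Proof.
move=> H; exists (\matrix_(i, j) 'D_v (fun y => M y i j) x) => i j; rewrite mxE.
by have [d [Hd _]] := H i j; apply: derivableP.
Qed.

Lemma metric_inv_is_derive (t : R) (phi : R -> tensor R 4) (A : 'M[R]_8) :
  (\near t, spin7_orbit (phi t)) ->
  tder t 1 phi (der (A *m metric_inv (phi t)) (phi t)) ->
  mder t 1 (fun u => metric_inv (phi u))
    (- (metric_inv (phi t) *m (A + A^T) *m metric_inv (phi t))).
Proof.
move=> O phid; have tO := nbhs_singleton O.
have [|dG GH] := @mder_ex _ t 1 (fun u => metric_inv (phi u)).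
  move=> i j; have [D DH] := elementary_is_derive (der (A *m metric_inv (phi t)) (phi t))
    (elementary_metric_inv R i j) tO.
  by exists D; exact: (DH t phi erefl O phid).
apply: (@mder_inv R _ t 1 (fun u => metric (phi u))) (metric_is_derive O phid) GH.
  by apply: filterS O => u; apply: metric_invK.
exact: metricK.
Qed.

(* With E the difference of the two sides without their last term, the equation
   for [N] puts E - S in the kernel of the action on [phi], that is in Omega^2_21,
   whereas E lies in Omega^2_7. The existence of the derivative of [T] follows from
   [contract_diamond], which gives 96 T as a contraction of [N] with [phi]. *)
Lemma torsion_variation (t : R) (phi N : R -> tensor R 4) (T : R -> 'M[R]_8) (A S : 'M[R]_8) :
  let G u := metric_inv (phi u) in
  (\near t, spin7_orbit (phi t)) ->
  tder t 1 phi (der (A *m G t) (phi t)) ->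
  tder t 1 N (fun s => der (S *m G t) (phi t) s + der (A *m G t) (N t) s) ->
  (\forall u \near t, [/\ (T u)^T = - T u, ctr2 (phi u) (G u *m T u *m G u) = - 6 *: T u &
     forall s, N u s = der (T u *m G u) (phi u) s]) ->
  S^T = - S ->
  mder t 1 T (A *m G t *m T t + T t *m G t *m A^T +
    (4^-1 *: S - 8^-1 *: ctr2 (phi t) (G t *m S *m G t))).
Proof.
move=> G O phid Nd TP Sskew; have tO := nbhs_singleton O.
have [Tskew T7 TN] := nbhs_singleton TP.
pose dG := - (G t *m (A + A^T) *m G t).
have Gd : mder t 1 G dG := metric_inv_is_derive O phid.
have [|Td TH] := @mder_ex _ t 1 T.
  move=> i j; have [d dH] := ctr3_derivable i j Gd Nd phid.
  (* 96 = 24 + 12 * 6, the value of [contract_diamond] on Omega^2_7. *)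
  exists (96^-1 * d); apply: near_eq_is_derive (is_deriveZf 96^-1 dH).
  near=> u; have [Tu T7u TNu] : [/\ (T u)^T = - T u,
     ctr2 (phi u) (G u *m T u *m G u) = - 6 *: T u &
     forall s, N u s = der (T u *m G u) (phi u) s] by near: u.
  have uO : spin7_orbit (phi u) by near: u.
  have -> : N u = der (T u *m G u) (phi u) by apply/funext.
  rewrite (contract_diamond uO i j Tu) T7u !mxE.
  by move: (T u i j) => y; field.
have [E EE] : exists E, E = Td - A *m G t *m T t - T t *m G t *m A^T by eexists.
have TdE : Td = E + A *m G t *m T t + T t *m G t *m A^T.
  by rewrite EE; apply/matrixP => i j; rewrite !mxE; ring.
suff <- : E = 4^-1 *: S - 8^-1 *: ctr2 (phi t) (G t *m S *m G t).
  suff -> : A *m G t *m T t + T t *m G t *m A^T + E = Td by [].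
  by rewrite TdE addrC addrA.
have GtT : (G t)^T = G t := metric_inv_tr (phi t).
have Tdskew : Td^T = - Td.
  have H := mderZ (-1) TH; rewrite scaleN1r in H.
  apply: mder_unique (mderT TH) _; apply: mder_near H.
  by apply: filterS TP => u [-> _ _]; rewrite scaleN1r.
have trB (M P : 'M[R]_8) : (M - P)^T = M^T - P^T by apply/matrixP => i j; rewrite !mxE.
have Eskew : E^T = - E.
  rewrite EE !trB !trmx_mul trmxK GtT Tskew Tdskew !mulmxN !mulNmx !mulmxA.
  move: (A *m _ *m _) (T t *m _ *m _) => p q.
  by apply/matrixP => i j; rewrite !mxE; ring.
(* The terms of G' and those that [ctr2_der] moves to the inner factor change T' into E inside the
   contraction; the two outer terms of [ctr2_der] change -6 T' into -6 E. *)
have E7 : ctr2 (phi t) (G t *m E *m G t) = - 6 *: E.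
  have H := mder_ctr2 (mderM (mderM Gd TH) Gd) phid.
  have H6 := mderZ (-6) TH.
  have N7 : \near t, ctr2 (phi t) (G t *m T t *m G t) = - 6 *: T t.
    by apply: filterS TP => u [].
  have K := mder_unique (mder_near N7 H) H6.
  move: K; rewrite ctr2_der T7 addrA addrA -ctr2D trmx_mul GtT.
  have -> : (dG *m T t + G t *m Td) *m G t + G t *m T t *m dG +
    (G t *m A^T *m (G t *m T t *m G t) + G t *m T t *m G t *m (A *m G t)) = G t *m E *m G t.
    rewrite /dG EE !(mulmxDl, mulmxDr, mulmxN, mulNmx, opprD) !mulmxA.
    move: (G t *m A *m G t *m T t *m G t) (G t *m A^T *m G t *m T t *m G t)
     (G t *m Td *m G t) (G t *m T t *m G t *m A *m G t) (G t *m T t *m G t *m A^T *m G t) => p q r s u.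
    by apply/matrixP => i j; rewrite !mxE; ring.
  rewrite -!scalemxAr -!scalemxAl TdE !mulmxA.
  move: (ctr2 _ _) (A *m G t *m T t) (T t *m G t *m A^T) => Z p q K.
  by apply/matrixP => i j; move/matrixP/(_ i j): K; rewrite !mxE; lra.
(* Two expressions for the derivative of N are compared; they apply T G and A G in opposite orders,
   and the difference is the commutator from [der_comm]. *)
have W0 s : der ((E - S) *m G t) (phi t) s = 0.
  have H := tder_der (mderM TH Gd) phid.
  have N3 : \near t, der (T t *m G t) (phi t) s = N t s.
    by apply: filterS TP => u [].
  have {}H := is_derive_unique (near_eq_is_derive N3 (H s)) (Nd s).
  have NtE : N t = der (T t *m G t) (phi t) by apply/funext.
  rewrite NtE in H.
  have C := der_comm (T t *m G t) (A *m G t) (phi t) s.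
  have -> : (E - S) *m G t = Td *m G t + T t *m dG +
     (T t *m G t *m (A *m G t) - A *m G t *m (T t *m G t)) + - (S *m G t).
    rewrite EE /dG !(mulmxDl, mulmxDr, mulmxN, mulNmx, opprD) !mulmxA.
    move: (Td *m G t) (A *m G t *m T t *m G t) (T t *m G t *m A^T *m G t) (S *m G t)
      (T t *m G t *m A *m G t) => p q r u y.
    by apply/matrixP => i j; rewrite !mxE; ring.
  rewrite derDl derDl derNl -C; move: H.
  have AC (p q r u : R) : p + q = r + u -> p + (q - u) - r = 0 by move=> ?; lra.
  exact: AC.
have Wskew : (E - S)^T = - (E - S) by rewrite trB Eskew Sskew opprB addrC opprK.
(* E is fixed by pi_7, since 1/4 + 6/8 = 1, while E - S is killed by it. *)
have := der_diamond_eq0 tO Wskew W0; rewrite -/(G t) mulmxBr mulmxBl ctr2D ctr2N E7.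
move: (ctr2 _ _) => Z /matrixP EZ; apply/matrixP => i j; have := EZ i j; rewrite !mxE.
move: (E i j) (S i j) (Z i j) => p q r; lra.
Unshelve. all: by end_near. Qed.
End Variation.

Lemma derE2 (R : realType) (B : 'M[R]_8) (F : tensor R 2) i j :
  der B F [tuple i; j] = (B *m mx2 F + mx2 F *m B^T) i j.
Proof.
rewrite /der big_ord_recl (big_ord_recl 0) big_ord0 addr0 !mxE; congr (_ + _);
  apply: eq_bigr => p _; rewrite !mxE.
  by congr (_ * F _); apply: eq_from_tnth => -[[|[|//]] ?]; rewrite tnth_upd.
rewrite mulrC; congr (F _ * _).
by apply: eq_from_tnth => -[[|[|//]] ?]; rewrite tnth_upd.
Qed.

(** * Covariant derivatives and smoothness of the metric in a chart *)

Section Chart.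
Variables (R : realType) (M : manifold8 R).

Definition dmetric (Phi : tfield M 4) (c : chart M) (x : 'rV[R]_8) (k : 'I_8) : 'M[R]_8 :=
  \matrix_(i, j) 'D_('e_k) (fun y => metric (Phi c y) i j) x.

Lemma christoffelE (Phi : tfield M 4) c x p m i :
  christoffel Phi c x p m i = gamma (metric_inv (Phi c x)) (dmetric Phi c x) m i p.
Proof.
have DE k a b : dmetric Phi c x k a b = 'D_('e_k) (fun y => metric (Phi c y) a b) x.
  by rewrite mxE.
rewrite /christoffel /gamma mxE mxE; congr (_ * _); apply: eq_bigr => q _.
have -> : metric_inv (Phi c x) p q = metric_inv (Phi c x) q p.
  by rewrite -[in LHS]metric_inv_tr [LHS]mxE.
rewrite [LHS]mulrC.
have -> : lowered_christoffel (dmetric Phi c x) m i q = dmetric Phi c x m i q +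
    dmetric Phi c x i m q - dmetric Phi c x q m i.
  by rewrite [LHS]mxE.
congr (_ * _); congr (_ + _ - _); exact/esym/DE.
Qed.

Lemma nablaE (Phi : tfield M 4) n (S : tfield M n) c x m s :
  nabla Phi S c x m s = 'D_('e_m) (fun y => S c y s) x -
    der (gamma (metric_inv (Phi c x)) (dmetric Phi c x) m) (S c x) s.
Proof.
congr (_ - _); apply: eq_bigr => r _; apply: eq_bigr => p _.
by rewrite christoffelE.
Qed.

Lemma nabla2E (Phi : tfield M 4) (S : tfield M 2) c x m i j :
  nabla Phi S c x m [tuple i; j] =
    cov (metric_inv (Phi c x)) (dmetric Phi c x) m (mx2 (S c x))
      (\matrix_(i, j) 'D_('e_m) (fun y => S c y [tuple i; j]) x) i j.
Proof.
rewrite nablaE derE2 /cov.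
have subE (A B : 'M[R]_8) : (A - B) i j = A i j - B i j by rewrite !mxE.
by rewrite !subE [(\matrix_(_, _) _) i j]mxE [(_ + _ *m _) i j]mxE opprD addrA.
Qed.

Lemma open_chart_image (c : chart M) : open (chart_image c).
Proof. exact: coord_open. Qed.

Section AtTime.
Variables (J : set R) (Phi : R -> tfield M 4) (c : chart M).
Hypotheses (oJ : open J) (famPhi : smooth_family J Phi).
Hypothesis spinPhi : forall t, J t -> spin7_structure (Phi t).
Let U := chart_image c.

Lemma orbit_chart u y : J u -> U y -> spin7_orbit (Phi u c y).
Proof. by move=> /spinPhi[_ O] /O. Qed.

Lemma Ck_Phi k s : Ck_on k (J `*` U) (fun z : R * 'rV[R]_8 => Phi z.1 c z.2 s).
Proof. exact: (proj2 famPhi). Qed.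

(** Joint regularity in time and space is what permits exchanging the time derivative with the
    coordinate derivatives in the Christoffel symbols. *)
Lemma Ck_metric k i j :
  Ck_on k (J `*` U) (fun z : R * 'rV[R]_8 => metric (Phi z.1 c z.2) i j).
Proof.
apply: (elementary_Ck (phi := fun z : R * 'rV[R]_8 => Phi z.1 c z.2) _ (elementary_metric R i j)).
- by apply: open_setX => //; apply: open_chart_image.
- by move=> [u y] [/= Ju Uy]; apply: orbit_chart.
- by move=> s; apply: Ck_Phi.
Qed.

Lemma mder_metric t x k : J t -> U x ->
  mder x 'e_k (fun y => metric (Phi t c y)) (dmetric (Phi t) c x k).
Proof.
move=> Jt Ux i j; rewrite mxE.
have := is_derive_slice (Ck_metric 2 i j) 'e_k Jt Ux.
by move=> [H _]; apply: derivableP.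
Qed.

Lemma near_J t : J t -> \forall u \near t, J u.
Proof. by move=> Jt; apply: open_nbhs_nbhs. Qed.

Lemma near_U x : U x -> \forall y \near x, U y.
Proof. by move=> Ux; apply: open_nbhs_nbhs; split=> //; apply: open_chart_image. Qed.

Lemma dmetric_tr t x k : J t -> U x -> (dmetric (Phi t) c x k)^T = dmetric (Phi t) c x k.
Proof.
move=> Jt Ux; have H := mderT (mder_metric k Jt Ux).
rewrite (_ : (fun y => _) = fun y => metric (Phi t c y)) in H; last first.
  by apply/funext => y; rewrite metric_tr.
exact: mder_unique H (mder_metric k Jt Ux).
Qed.

Lemma mder_metric_inv t x k : J t -> U x ->
  mder x 'e_k (fun y => metric_inv (Phi t c y))
    (- (metric_inv (Phi t c x) *m dmetric (Phi t) c x k *m metric_inv (Phi t c x))).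
Proof.
move=> Jt Ux; have [|dG GH] := @mder_ex _ _ x 'e_k (fun y => metric_inv (Phi t c y)).
  move=> i j.
  have Ck : Ck_on 1 U (fun y => metric_inv (Phi t c y) i j).
    apply: (elementary_Ck (phi := fun y => Phi t c y) _ (elementary_metric_inv R i j)).
    - exact: open_chart_image.
    - by move=> y Uy; apply: orbit_chart.
    - by move=> s; have [[_ H] _] := spinPhi Jt; apply: H.
  by eexists; apply: Ck_on_derive Ck Ux.
apply: (@mder_inv R _ x 'e_k (fun y => metric (Phi t c y))) (mder_metric k Jt Ux) GH.
  by apply: filterS (near_U Ux) => y Uy; apply: metric_invK; apply: orbit_chart.
by apply: metricK; apply: orbit_chart.
Qed.

End AtTime.
End Chart.

(** * Evolution of the connection and of the torsion in a chart *)

Section Evolution.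
Variables (R : realType) (M : manifold8 R) (J : set R).
Variables (Phi : R -> tfield M 4) (h X : R -> tfield M 2) (T : R -> tfield M 3).
Hypotheses (oJ : open J) (famPhi : smooth_family J Phi).
Hypothesis spinPhi : forall t, J t -> spin7_structure (Phi t).
Hypothesis smooth_h : forall t, J t -> smooth_tfield (h t).
Hypothesis h_sym : forall t c x, J t -> chart_image c x ->
  forall i j, h t c x [tuple i; j] = h t c x [tuple j; i].
Hypothesis smooth_X : forall t, J t -> smooth_tfield (X t).
Hypothesis X7 : forall t c x, J t -> chart_image c x -> Omega2_7 (Phi t c x) (X t c x).
Let A0 : R -> tfield M 2 := fun t c x s => h t c x s + X t c x s.
Hypothesis evol : forall t c x, J t -> chart_image c x -> forall i j k l,
  is_derive t 1 (fun u => Phi u c x [tuple i; j; k; l]) (diamond (Phi t c x) (A0 t c x) i j k l).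
Hypothesis torsT : forall t, J t -> is_torsion (Phi t) (T t).

Variables (t : R) (c : chart M).
Hypothesis Jt : J t.
Let U := chart_image c.
Let G y := metric_inv (Phi t c y).
Let H y := mx2 (h t c y).
Let Y y := mx2 (X t c y).
Let A y := H y + Y y.

Lemma mx2A0 y : mx2 (A0 t c y) = A y.
Proof. by apply/matrixP => i j; rewrite !mxE. Qed.

Lemma tder_Phi y : U y -> tder t 1 (fun u => Phi u c y) (der (A y *m G y) (Phi t c y)).
Proof.
move=> Uy s; have [i [j [k [l ->]]]] := tuple4_eta s.
by have := evol Jt Uy i j k l; rewrite diamondE mx2A0.
Qed.

Lemma near_orbit y : U y -> \forall u \near t, spin7_orbit (Phi u c y).
Proof.
move=> Uy; apply: filterS (near_J oJ Jt) => u Ju.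
exact: orbit_chart spinPhi _ _ Ju Uy.
Qed.

Lemma H_tr y : U y -> (H y)^T = H y.
Proof. by move=> Uy; apply/matrixP => i j; rewrite !mxE h_sym. Qed.

Lemma Y_tr y : U y -> (Y y)^T = - Y y.
Proof.
move=> Uy; have O : spin7_orbit (Phi t c y) := orbit_chart spinPhi Jt Uy.
by have [] := Omega2_7P O (X7 Jt Uy).
Qed.

Lemma A_sym y : U y -> A y + (A y)^T = 2 *: H y.
Proof.
move=> Uy; rewrite /A linearD /= H_tr // Y_tr //; move: (H y) (Y y) => p q.
by apply/matrixP => i j; rewrite !mxE; ring.
Qed.

Lemma mder_metric_time y : U y -> mder t 1 (fun u => metric (Phi u c y)) (2 *: H y).
Proof.
move=> Uy; rewrite -A_sym //.
apply: metric_is_derive; [exact: near_orbit | exact: tder_Phi].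
Qed.

Lemma mder_metric_inv_time y : U y ->
  mder t 1 (fun u => metric_inv (Phi u c y)) (- (G y *m (2 *: H y) *m G y)).
Proof.
move=> Uy; rewrite -A_sym //.
apply: metric_inv_is_derive; [exact: near_orbit | exact: tder_Phi].
Qed.

Variable x : 'rV[R]_8.
Hypothesis Ux : U x.
Let dH k : 'M[R]_8 := \matrix_(i, j) 'D_('e_k) (fun y => h t c y [tuple i; j]) x.
Let dY k : 'M[R]_8 := \matrix_(i, j) 'D_('e_k) (fun y => X t c y [tuple i; j]) x.
Let dg u := dmetric (Phi u) c x.

Lemma mder_H k : mder x 'e_k H (dH k).
Proof.
move=> i j; rewrite mxE (_ : (fun y => _) = fun y => h t c y [tuple i; j]); last first.
  by apply/funext => y; rewrite mxE.
have [_ /(_ c [tuple i; j] 1%N) Hk] := smooth_h Jt.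
exact: Ck_on_derive Hk Ux.
Qed.

Lemma mder_Y k : mder x 'e_k Y (dY k).
Proof.
move=> i j; rewrite mxE (_ : (fun y => _) = fun y => X t c y [tuple i; j]); last first.
  by apply/funext => y; rewrite mxE.
have [_ /(_ c [tuple i; j] 1%N) Xk] := smooth_X Jt.
exact: Ck_on_derive Xk Ux.
Qed.

Lemma dH_tr k : (dH k)^T = dH k.
Proof.
apply: mder_unique (mderT (mder_H k)) _; apply: mder_near (mder_H k).
by apply: filterS (near_U Ux) => y Uy; rewrite H_tr.
Qed.

Lemma dY_tr k : (dY k)^T = - dY k.
Proof.
rewrite -[- _]scaleN1r; apply: mder_unique (mderT (mder_Y k)) _.
apply: mder_near (mderZ (-1) (mder_Y k)).
by apply: filterS (near_U Ux) => y Uy; rewrite Y_tr // scaleN1r.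
Qed.

Lemma mder_dmetric_time k : mder t 1 (fun u => dg u k) (2 *: dH k).
Proof.
move=> i j; rewrite (_ : (fun u => _) =
  fun u => 'D_('e_k) (fun y => metric (Phi u c y) i j) x); last first.
  by apply/funext => u; rewrite mxE.
have := is_derive_mixed oJ (@open_chart_image _ _ c) (Ck_metric c oJ famPhi spinPhi 2 i j) 'e_k Jt Ux
  (fun y Uy => mder_metric_time Uy i j).
by have [_ ->] := mderZ 2 (mder_H k) i j.
Qed.

Lemma mder_gamma_time m :
  mder t 1 (fun u => gamma (metric_inv (Phi u c x)) (dg u) m)
    (dgamma (G x) (H x) (dg t) dH m).
Proof.
apply: mderZ; apply: mderM; last exact: mder_metric_inv_time.
move=> i q; rewrite mxE (_ : (fun u => _) =
  fun u => dg u m i q + dg u i m q - dg u q m i); last first.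
  by apply/funext => u; rewrite mxE.
by apply: is_deriveBf; [apply: is_deriveDf|]; apply: mder_dmetric_time.
Qed.

Lemma tder_dPhi m : tder x 'e_m (fun y => Phi t c y)
  (fun s => 'D_('e_m) (fun y => Phi t c y s) x).
Proof.
move=> s; have [[_ /(_ c s 1%N) Hs] _] := spinPhi Jt.
exact: Ck_on_derive Hs Ux.
Qed.

Definition source m : 'M[R]_8 := \matrix_(i, j)
  (nabla (Phi t) (h t) c x j [tuple i; m] - nabla (Phi t) (h t) c x i [tuple j; m]
   + nabla (Phi t) (X t) c x m [tuple i; j]).

Let tO : spin7_orbit (Phi t c x) := orbit_chart spinPhi Jt Ux.

(** Exchanging derivatives turns the time derivative of the partial derivative of Phi into that of
    [der (A G) Phi], and the connection term adds [dgamma]. Moving [gamma] past A G leaves the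
    commutator that [torsion_source] absorbs, together with the action of A G on nabla Phi. *)
Lemma tder_nabla_time m :
  tder t 1 (fun u => nabla (Phi u) (Phi u) c x m)
    (fun s => der (source m *m G x) (Phi t c x) s +
              der (A x *m G x) (nabla (Phi t) (Phi t) c x m) s).
Proof.
pose dAG := (dH m + dY m) *m G x + A x *m (- (G x *m dg t m *m G x)).
have AGd : mder x 'e_m (fun y => A y *m G y) dAG.
  apply: mderM; first by apply: mderD; [exact: mder_H | exact: mder_Y].
  exact: (mder_metric_inv oJ famPhi spinPhi m Jt Ux).
have Dd := tder_der AGd (tder_dPhi m).
have Ed := tder_der (mder_gamma_time m) (tder_Phi Ux).
move=> s; rewrite (_ : (fun u => _) = fun u => 'D_('e_m) (fun y => Phi u c y s) x -
   der (gamma (metric_inv (Phi u c x)) (dg u) m) (Phi u c x) s); last first.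
  by apply/funext => u; rewrite nablaE.
have D1 := is_derive_mixed oJ (@open_chart_image _ _ c) (Ck_Phi c famPhi 2 s) 'e_m Jt Ux
  (fun y Uy => tder_Phi Uy s).
have [_ D1E] := Dd s; rewrite D1E in D1.
apply: is_derive_eq (is_deriveBf D1 (Ed s)) _.
set Gam := gamma _ _ m.
have -> : nabla (Phi t) (Phi t) c x m = fun s =>
    'D_('e_m) (fun y => Phi t c y s) x - der Gam (Phi t c x) s.
  by apply/funext => s'; rewrite nablaE.
rewrite derB.
have -> : source m *m G x = dAG + (A x *m G x *m Gam - Gam *m (A x *m G x))
    - dgamma (G x) (H x) (dg t) dH m.
  rewrite /dAG /Gam (torsion_source (metricK tO) (metric_invK tO) (metric_tr _)
     (H_tr Ux) (fun k => dmetric_tr oJ famPhi spinPhi k Jt Ux) dH_tr (erefl _)).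
  by congr (_ *m _); apply/matrixP => i j; rewrite [LHS]mxE [RHS]mxE !nabla2E.
clearbody dAG; rewrite derDl derDl derNl -der_comm -/Gam.
move: (der dAG _ s) (der (A x *m G x) _ s) (der (dgamma _ _ _ _ _) _ s).
move: (der Gam _ s) (der (A x *m G x) (der Gam _) s) => p q r u y.
by ring.
Qed.

(** The two h terms are exchanged with opposite signs; for the X term, covariant differentiation
    preserves skew symmetry. *)
Lemma source_tr m : (source m)^T = - source m.
Proof.
have XE i j : nabla (Phi t) (X t) c x m [tuple i; j] = - nabla (Phi t) (X t) c x m [tuple j; i].
  rewrite !nabla2E -/(Y x) -/(dY m).
  have <- : (cov (G x) (dg t) m (Y x) (dY m))^T j i = cov (G x) (dg t) m (Y x) (dY m) i j.
    by rewrite [LHS]mxE.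
  have -> : (cov (G x) (dg t) m (Y x) (dY m))^T = - cov (G x) (dg t) m (Y x) (dY m).
    rewrite /cov; set Gam := gamma _ _ m.
    have trB (N P : 'M[R]_8) : (N - P)^T = N^T - P^T by apply/matrixP => k l; rewrite !mxE.
    rewrite !trB !trmx_mul trmxK (Y_tr Ux) dY_tr !(mulNmx, mulmxN).
    move: (dY m) (Y x *m _) (Gam *m _) => p q r.
    by apply/matrixP => k l; rewrite !mxE; ring.
  by rewrite [LHS]mxE.
have sE i j : source m i j = nabla (Phi t) (h t) c x j [tuple i; m] -
    nabla (Phi t) (h t) c x i [tuple j; m] + nabla (Phi t) (X t) c x m [tuple i; j].
  by rewrite [LHS]mxE.
apply/matrixP => i j; rewrite [LHS]mxE [RHS]mxE !sE (XE j i).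
move: (nabla _ _ _ _ _ _) (nabla _ _ _ _ _ _) (nabla _ _ _ _ _ _) => p q r.
by ring.
Qed.

Definition torsion_mx u m : 'M[R]_8 := mx2 (fun s => T u c x [tuple of m :: s]).

Lemma torsion_mx_is_derive m :
  mder t 1 (torsion_mx ^~ m)
    (A x *m G x *m torsion_mx t m + torsion_mx t m *m G x *m (A x)^T +
     (4^-1 *: source m - 8^-1 *: ctr2 (Phi t c x) (G x *m source m *m G x))).
Proof.
apply: (torsion_variation (near_orbit Ux) (tder_Phi Ux) (tder_nabla_time m)); last first.
  exact: source_tr.
apply: filterS (near_J oJ Jt) => u Ju.
have uO : spin7_orbit (Phi u c x) := orbit_chart spinPhi Ju Ux.
have [T7 TN] := torsT Ju Ux m.
have [Tskew T7'] := Omega2_7P uO T7; split=> // s.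
have [i [j [k [l ->]]]] := tuple4_eta s.
by rewrite TN diamondE.
Qed.
End Evolution.

Theorem theorem3p4 (R : realType) (M : manifold8 R) (J : set R)
    (Phi : R -> tfield M 4) (h X : R -> tfield M 2) (T : R -> tfield M 3) :
  open J -> is_interval J ->
  smooth_family J Phi ->
  (forall t, J t -> spin7_structure (Phi t)) ->
  (forall t, J t -> smooth_tfield (h t)) ->
  (forall t c x, J t -> chart_image c x ->
     forall i j, h t c x [tuple i; j] = h t c x [tuple j; i]) ->
  (forall t, J t -> smooth_tfield (X t)) ->
  (forall t c x, J t -> chart_image c x -> Omega2_7 (Phi t c x) (X t c x)) ->
  let A : R -> tfield M 2 := fun t c x s => h t c x s + X t c x s in
  (forall t c x, J t -> chart_image c x -> forall i j k l,
     is_derive t 1 (fun u => Phi u c x [tuple i; j; k; l])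
       (diamond (Phi t c x) (A t c x) i j k l)) ->
  (forall t, J t -> is_torsion (Phi t) (T t)) ->
  forall t c x, J t -> chart_image c x -> forall m a b : 'I_8,
    is_derive t 1 (fun u => T u c x [tuple m; a; b])
      (\sum_(p < 8) \sum_(q < 8) A t c x [tuple a; p] *
         metric_inv (Phi t c x) p q * T t c x [tuple m; q; b]
       - \sum_(p < 8) \sum_(q < 8) A t c x [tuple b; p] *
           metric_inv (Phi t c x) p q * T t c x [tuple m; q; a]
       + pi7 (Phi t c x)
           (fun i j => nabla (Phi t) (h t) c x j [tuple i; m]
                       - nabla (Phi t) (h t) c x i [tuple j; m]
                       + nabla (Phi t) (X t) c x m [tuple i; j]) a b).
Proof.
move=> oJ _ famPhi spinPhi smooth_h h_sym smooth_X X7 A evol torsT t c x Jt Ux m a b.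
have H := @torsion_mx_is_derive R M J Phi h X T oJ famPhi spinPhi smooth_h h_sym smooth_X
  X7 evol torsT t c Jt x Ux m a b.
have TE u i j : torsion_mx T c x u m i j = T u c x [tuple m; i; j].
  by rewrite [LHS]mxE; congr (T u c x _); apply: val_inj.
have Tskew i j : T t c x [tuple m; i; j] = - T t c x [tuple m; j; i].
  have [[Ts _] _] := torsT t Jt c x Ux m.
  by rewrite -!TE [LHS]mxE [X in _ = - X]mxE Ts.
rewrite (_ : (fun u => _) = fun u => T u c x [tuple m; a; b]) in H; last first.
  by apply/funext => u; rewrite TE.
apply: is_derive_eq H _; rewrite pi7E [LHS]mxE [X in X + _ = _]mxE; congr (_ + _ + _).
  rewrite mxE exchange_big; apply: eq_bigr => q _ /=.
  rewrite mxE mulr_suml TE; apply: eq_bigr => p _; congr (_ * _ * _).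
  by rewrite -mx2A0 mxE.
(* The matrix term T G A^T has its free indices in the order a, b; skew symmetry of T brings it to
   the stated form and produces the minus sign. *)
rewrite mxE -sumrN; apply: eq_bigr => p _; rewrite -sumrN mxE mulr_suml.
apply: eq_bigr => q _; rewrite TE (Tskew a q) !mxE.
have -> : metric_inv (Phi t c x) q p = metric_inv (Phi t c x) p q.
  by rewrite -[in LHS]metric_inv_tr [LHS]mxE.
by rewrite !mulNr [X in - X = _]mulrC [X in - (_ * X) = _]mulrC mulrA.
Qed.
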